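(* Let $X_0\in\mathbb{R}^{n\times p_0}$ and $X\in\mathbb{R}^{n\times p}$ be such that the columns of $(X_0,X)$ are linearly independent, $X_0'X=0_{p_0\times p}$, and $n>p+p_0$. Let $Y\in\mathbb{R}^n$ be such that the residual sum of squares of $Y$ after least-squares regression on $(X_0,X)$ is positive. For each of the $2^p$ subsets of the columns of $X$ let $\mathcal{M}_i$ be the corresponding model, and let $\mathsf{BF}_{i0,\mathsf{BIC}}$, $\mathsf{BF}_{i0,\mathsf{ML}}$, $\mathsf{BF}_{i0,\mathsf{LB}}$ be its null-based Bayes factors under BIC, the restricted type II ML prior, and the lower bound prior, respectively (as defined in the context). For each of the three methods put $\mathsf{BF}_{ji}=\mathsf{BF}_{j0}/\mathsf{BF}_{i0}$. (1) If $\mathcal{M}_j\supset\mathcal{M}_i$ (that is, $\mathcal{M}_j$ contains all the predictors in $\mathcal{M}_i$), then $$\mathsf{BF}_{ji,\mathsf{BIC}}\ \ge\ \mathsf{BF}_{ji,\mathsf{ML}}\ \ge\ \mathsf{BF}_{ji,\mathsf{LB}} .$$ (2) Let $\mathcal{M}_f$ be the full model (which includes all $p$ predictors) and $\mathcal{M}_0$ the null model (which includes none of them). If the prior on the model space is the same for the three methods, then $$\mathbb{P}_{\mathsf{BIC}}(\mathcal{M}_f\mid Y)\ge\mathbb{P}_{\mathsf{ML}}(\mathcal{M}_f\mid Y)\ge\mathbb{P}_{\mathsf{LB}}(\mathcal{M}_f\mid Y),$$ $$\mathbb{P}_{\mathsf{BIC}}(\mathcal{M}_0\mid Y)\le\mathbb{P}_{\mathsf{ML}}(\mathcal{M}_0\mid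 Y)\le\mathbb{P}_{\mathsf{LB}}(\mathcal{M}_0\mid Y).$$
   Context: A prime denotes transpose. For a subset of $p_i\in\{0,\dots,p\}$ columns of $X$, let $X_i$ be the $n\times p_i$ matrix of these columns; model $\mathcal{M}_i$ is $Y=X_0\beta_0+X_i\beta_i+\epsilon$, $\epsilon\sim N_n(0_n,\sigma^2I_n)$. The null model $\mathcal{M}_0$ is $Y=X_0\beta_0+\epsilon$ ($p_i=0$). Define $\widehat\beta_0=(X_0'X_0)^{-1}X_0'Y$, let $\mathsf{SSE}_i$ be the residual sum of squares of the least-squares regression of $Y$ on $(X_0,X_i)$, and set $R_i^2=1-\mathsf{SSE}_i/\lVert Y-X_0\widehat\beta_0\rVert^2$ (so $R_i^2=0$ for the null model). Null-based Bayes factors: - BIC: $\mathsf{BF}_{i0,\mathsf{BIC}}=n^{-p_i/2}(1-R_i^2)^{-n/2}$, obtained by treating $\exp(-\mathsf{BIC}/2)$ as an approximate marginal likelihood. - Lower bound prior (LB): $\mathsf{BF}_{i0,\mathsf{LB}}=m_i(Y)/m_0(Y)$ is the ratio of marginal likelihoods of $\mathcal{M}_i$ and $\mathcal{M}_0$ with prior $\beta_i\mid\sigma^2\sim N_{p_i}(0_{p_i},\sigma^2n(X_i'X_i)^{-1})$, $\pi(\beta_0,\sigma^2)\propto1/\sigma^2$ under $\mathcal{M}_i$ and $\pi_0(\beta_0,\sigma^2)\propto1/\sigma^2$ under $\mathcal{M}_0$. In closed form, $\mathsf{BF}_{i0,\mathsf{LB}}=(n+1)^{\frac{n-p_0-p_i}{2}}[n(1-R_i^2)+1]^{-(n-p_0)/2}$.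 - Restricted type II ML prior (ML): same as LB, except that under $\mathcal{M}_i$ the prior is $\beta_i\mid\sigma^2\sim N_{p_i}(0_{p_i},\sigma^2\widehat W_i)$, where $\widehat W_i$ maximizes the marginal likelihood of $\mathcal{M}_i$ under the prior $N_{p_i}(0_{p_i},\sigma^2W)$ over all $W$ such that $W-n(X_i'X_i)^{-1}$ is positive semidefinite. In closed form, $$\mathsf{BF}_{i0,\mathsf{ML}}=\begin{cases}(n+1)^{\frac{n-p_0-p_i}{2}}\left[n(1-R_i^2)+1\right]^{-(n-p_0)/2}&\text{if }R_i^2\le\frac{n+1}{2n-p_0},\\[4pt]\varphi_i(n)^{-1/2}(R_i^2)^{-1/2}(1-R_i^2)^{-(n-p_0-1)/2}&\text{if }R_i^2>\frac{n+1}{2n-p_0},\end{cases}$$ with $\varphi_i(n)=\dfrac{(n+1)^{p_i-1}(n-p_0)^{n-p_0}}{(n-p_0-1)^{n-p_0-1}}$. All three equal $1$ for the null model. Given a prior probability distribution $\mathbb{P}(\mathcal{M}_i)$ on the $2^p$ models, the posterior model probabilities under method $\mathsf{A}\in\{\mathsf{BIC},\mathsf{ML},\mathsf{LB}\}$ are $\mathbb{P}_{\mathsf{A}}(\mathcal{M}_i\mid Y)=\mathbb{P}(\mathcal{M}_i)\,\mathsf{BF}_{i0,\mathsf{A}}\big/\sum_k\mathbb{P}(\mathcal{M}_k)\,\mathsf{BF}_{k0,\mathsf{A}}$, the sum being over all $2^p$ models. *)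

(* Defs.v *)
From mathcomp Require Import all_boot all_order all_algebra.
From mathcomp Require Import all_classical all_reals all_analysis.

Set Implicit Arguments.
Unset Strict Implicit.
Unset Printing Implicit Defensive.

Import Order.TTheory GRing.Theory Num.Theory.
Import numFieldNormedType.Exports.

Local Open Scope classical_set_scope.
Local Open Scope ring_scope.

(* Lebesgue integral over R^k of a nonnegative function, as an iterated
   integral over the coordinates (Tonelli).  R^0 is a single point of mass 1. *)
Fixpoint vec_integral (R : realType) (k : nat) :
    ('cV[R]_k -> \bar R) -> \bar R :=
  match k return ('cV[R]_k -> \bar R) -> \bar R with
  | 0%N => fun f => f 0
  | k'.+1 => fun f =>
      (\int[@lebesgue_measure R]_x
         vec_integral (fun v : 'cV[R]_k' => f (col_mx (x%:M : 'cV[R]_1) v)))%E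
  end.

(* Density of N_k(m, S); meaningful for S symmetric positive definite. *)
Definition mvnormal_pdf (R : realType) (k : nat) (m : 'cV[R]_k) (S : 'M[R]_k)
    (y : 'cV[R]_k) : R :=
  (Num.sqrt ((2 * pi) ^+ k * \det S))^-1 *
  expR (- (((y - m)^T *m invmx S *m (y - m)) 0 0 / 2)).

Definition psd (R : realType) (k : nat) (A : 'M[R]_k) : Prop :=
  A^T = A /\ forall v : 'cV[R]_k, 0 <= (v^T *m A *m v) 0 0.

Definition sqnorm (R : realType) (k : nat) (v : 'cV[R]_k) : R :=
  \sum_i v i 0 ^+ 2.

(* Least-squares coefficients, for Z of full column rank. *)
Definition lsq (R : realType) (n k : nat) (Z : 'M[R]_(n, k)) (Y : 'cV[R]_n) :
    'cV[R]_k :=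
  invmx (Z^T *m Z) *m (Z^T *m Y).

Definition SSE (R : realType) (n k : nat) (Z : 'M[R]_(n, k)) (Y : 'cV[R]_n) :
    R :=
  sqnorm (Y - Z *m lsq Z Y).

(* A model is identified with the set S of indices of its predictors; its
   number of predictors is #|S|, and set0, setT are the null and full models. *)
Definition design (R : realType) (n p : nat) (X : 'M[R]_(n, p))
    (S : {set 'I_p}) : 'M[R]_(n, #|S|) :=
  colsub (@enum_val _ (mem S)) X.

Definition Rsq (R : realType) (n p0 p : nat) (X0 : 'M[R]_(n, p0))
    (X : 'M[R]_(n, p)) (Y : 'cV[R]_n) (S : {set 'I_p}) : R :=
  1 - SSE (row_mx X0 (design X S)) Y / sqnorm (Y - X0 *m lsq X0 Y).

(* In both marginal likelihoods s2 stands for sigma^2, and the improper prior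
   on (beta_0, sigma^2) is normalized to be exactly 1 / sigma^2. *)
Definition marginal_null (R : realType) (n p0 : nat) (X0 : 'M[R]_(n, p0))
    (Y : 'cV[R]_n) : \bar R :=
  (\int[@lebesgue_measure R]_(s2 in `]0%R, +oo[)
     vec_integral (fun b0 : 'cV[R]_p0 =>
       (mvnormal_pdf (X0 *m b0) s2%:M Y * s2^-1)%:E))%E.

(* Prior N(0, sigma^2 W) on beta_i given sigma^2. *)
Definition marginal (R : realType) (n p0 p : nat) (X0 : 'M[R]_(n, p0))
    (X : 'M[R]_(n, p)) (Y : 'cV[R]_n) (S : {set 'I_p}) (W : 'M[R]_#|S|) :
    \bar R :=
  (\int[@lebesgue_measure R]_(s2 in `]0%R, +oo[)
     vec_integral (fun b0 : 'cV[R]_p0 =>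
       vec_integral (fun b : 'cV[R]_#|S| =>
         (mvnormal_pdf (X0 *m b0 + design X S *m b) s2%:M Y *
          mvnormal_pdf 0 (s2 *: W) b * s2^-1)%:E)))%E.

Definition LB_cov (R : realType) (n p : nat) (X : 'M[R]_(n, p))
    (S : {set 'I_p}) : 'M[R]_#|S| :=
  n%:R *: invmx ((design X S)^T *m design X S).

Definition ML_cov_set (R : realType) (n p0 p : nat) (X0 : 'M[R]_(n, p0))
    (X : 'M[R]_(n, p)) (Y : 'cV[R]_n) (S : {set 'I_p}) : set 'M[R]_#|S| :=
  [set W | psd (W - LB_cov X S) /\
     forall W', psd (W' - LB_cov X S) ->
       (marginal X0 X Y W' <= marginal X0 X Y W)%E].

(* A chosen maximizer (all maximizers give the same marginal likelihood);
   get returns an arbitrary matrix should no maximizer exist. *)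
Definition ML_cov (R : realType) (n p0 p : nat) (X0 : 'M[R]_(n, p0))
    (X : 'M[R]_(n, p)) (Y : 'cV[R]_n) (S : {set 'I_p}) : 'M[R]_#|S| :=
  get (ML_cov_set X0 X Y (S := S)).

Inductive method := BIC | ML | LB.

(* Null-based Bayes factor. *)
Definition BF0 (R : realType) (n p0 p : nat) (X0 : 'M[R]_(n, p0))
    (X : 'M[R]_(n, p)) (Y : 'cV[R]_n) (A : method) (S : {set 'I_p}) : R :=
  match A with
  | BIC => n%:R `^ (- (#|S|%:R / 2)) *
           (1 - Rsq X0 X Y S) `^ (- (n%:R / 2))
  | ML => fine (marginal X0 X Y (ML_cov X0 X Y S)) / fine (marginal_null X0 Y)
  | LB => fine (marginal X0 X Y (LB_cov X S)) / fine (marginal_null X0 Y)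
  end.

(* BF_{ji} for models J, I. *)
Definition BF (R : realType) (n p0 p : nat) (X0 : 'M[R]_(n, p0))
    (X : 'M[R]_(n, p)) (Y : 'cV[R]_n) (A : method) (J I : {set 'I_p}) : R :=
  BF0 X0 X Y A J / BF0 X0 X Y A I.

Definition posterior (R : realType) (n p0 p : nat) (X0 : 'M[R]_(n, p0))
    (X : 'M[R]_(n, p)) (Y : 'cV[R]_n) (prior : {set 'I_p} -> R) (A : method)
    (S : {set 'I_p}) : R :=
  prior S * BF0 X0 X Y A S / \sum_(K : {set 'I_p}) prior K * BF0 X0 X Y A K.

(* Main.v *)
Require Import Defs.
From mathcomp Require Import all_boot all_order all_algebra.
From mathcomp Require Import all_classical all_reals all_analysis.
From mathcomp Require Import measurable_realfun normal_distribution.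
From mathcomp Require Import ring lra.
Import Order.TTheory GRing.Theory Num.Theory.
Import numFieldNormedType.Exports.
Local Open Scope ring_scope.

Set Implicit Arguments.
Unset Strict Implicit.
Unset Printing Implicit Defensive.

(* Write N = n + 1, m = n - p0, let k be the number of predictors and r the R^2
   of a model, G the Gram matrix of its design and u = G^-1 X_i' Y.  Integrating
   out the regression coefficients (completing squares) and then sigma^2
   (scaling) gives, with P = G^-1 + W, the squared Bayes factor
     1 / (det P det G (1 - r + u' P^-1 u / T)^m),   T = |Y - X0 b0|^2,
   for the prior covariance W.  Let a = u' P^-1 u / u' G u.  The constraint
   P >= N G^-1 forces a <= 1/N and det P det G >= N^(k-1) / a, and every a in
   (0, 1/N] is attained with equality by a rank-one perturbation of the lower
   bound.  Hence ML is the maximum over a in (0, 1/N] of the square root of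
     f(k, r, a) = N a / (N^k (1 - r + a r)^m),
   and LB is its value at a = 1/N.  For fixed a, the ratios f(a) / f(1/N) and
   1 / (n^k (1 - r)^n f(a)) increase with r and k, hence along nested models;
   evaluating the maximum of one model at the maximizer of the other transfers
   this to ML / LB and BIC / ML.  The posterior comparisons then hold term by
   term in the normalizing sums. *)

(** * Positive definite matrices *)

Definition quad (R : realFieldType) k (A : 'M[R]_k) (v : 'cV[R]_k) : R :=
  (v^T *m A *m v) 0 0.

Definition pd (R : realFieldType) k (A : 'M[R]_k) : Prop :=
  A^T = A /\ forall v, v != 0 -> 0 < quad A v.

Lemma quad0 (R : realFieldType) k (A : 'M[R]_k) : quad A 0 = 0.
Proof. by rewrite /quad mulmx0 mxE. Qed.

Lemma quadDl (R : realFieldType) k (A B : 'M[R]_k) v :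
  quad (A + B) v = quad A v + quad B v.
Proof. by rewrite /quad mulmxDr mulmxDl mxE. Qed.

Lemma quadNl (R : realFieldType) k (A : 'M[R]_k) v : quad (- A) v = - quad A v.
Proof. by rewrite /quad mulmxN mulNmx mxE. Qed.

Lemma quadZl (R : realFieldType) k c (A : 'M[R]_k) v :
  quad (c *: A) v = c * quad A v.
Proof. by rewrite /quad -scalemxAr -scalemxAl mxE. Qed.

Lemma quadZr (R : realFieldType) k c (A : 'M[R]_k) v :
  quad A (c *: v) = c ^+ 2 * quad A v.
Proof.
rewrite /quad [(c *: v)^T]linearZ /= -scalemxAr -!scalemxAl scalerA -expr2.
by rewrite mxE.
Qed.

Lemma sym_dotC (R : realFieldType) k (A : 'M[R]_k) (u v : 'cV[R]_k) :
  A^T = A -> (v^T *m A *m u) 0 0 = (u^T *m A *m v) 0 0.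
Proof.
move=> sA; have -> : v^T *m A *m u = (u^T *m A *m v)^T.
  by rewrite !trmx_mul trmxK sA mulmxA.
by rewrite mxE.
Qed.

Lemma quadD (R : realFieldType) k (A : 'M[R]_k) (u v : 'cV[R]_k) :
  A^T = A ->
  quad A (u + v) = quad A u + 2 * (u^T *m A *m v) 0 0 + quad A v.
Proof.
move=> sA; rewrite /quad [(u + v)^T]linearD /= !mulmxDl !mulmxDr mxE.
by rewrite [X in X + _]mxE [X in _ + X]mxE (sym_dotC u v sA); ring.
Qed.

Lemma quad_outer (R : realFieldType) k (w v : 'cV[R]_k) :
  quad (w *m w^T) v = (w^T *m v) 0 0 ^+ 2.
Proof.
rewrite /quad mulmxA -mulmxA mxE big_ord1 expr2; congr (_ * _).
by rewrite -[v^T *m w]trmxK trmx_mul trmxK mxE.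
Qed.

Lemma quad_gram (R : realFieldType) n k (Z : 'M[R]_(n, k)) v :
  quad (Z^T *m Z) v = \sum_i ((Z *m v) i 0) ^+ 2.
Proof.
rewrite /quad mulmxA -trmx_mul -mulmxA mxE.
by apply: eq_bigr => i _; rewrite mxE expr2.
Qed.

Lemma outer_sym (R : realFieldType) k (w : 'cV[R]_k) :
  (w *m w^T)^T = w *m w^T.
Proof. by rewrite trmx_mul trmxK. Qed.

Lemma pd_ge0 (R : realFieldType) k (A : 'M[R]_k) v : pd A -> 0 <= quad A v.
Proof.
by case=> _ A0; have [->|/A0/ltW//] := eqVneq v 0; rewrite quad0.
Qed.

Lemma pd_unitmx (R : realFieldType) k (A : 'M[R]_k) : pd A -> A \in unitmx.
Proof.
case=> sA A0; rewrite -row_free_unit -kermx_eq0.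
apply/negPn/negP => /rowV0Pn[w /sub_kermxP wA w0].
have := A0 w^T; rewrite trmx_eq0 w0 /quad trmxK wA mul0mx mxE ltxx.
by move/(_ isT).
Qed.

Lemma pdD (R : realFieldType) k (A B : 'M[R]_k) :
  pd A -> B^T = B -> (forall v, 0 <= quad B v) -> pd (A + B).
Proof.
move=> [sA A0] sB B0; split; first by rewrite linearD /= sA sB.
by move=> v v0; rewrite quadDl ltr_wpDr// A0.
Qed.

Lemma pdZ (R : realFieldType) k c (A : 'M[R]_k) : 0 < c -> pd A -> pd (c *: A).
Proof.
move=> c0 [sA A0]; split; first by rewrite linearZ /= sA.
by move=> v v0; rewrite quadZl mulr_gt0// A0.
Qed.

Lemma quad_inv (R : realFieldType) k (A : 'M[R]_k) v :
  pd A -> quad A (invmx A *m v) = quad (invmx A) v.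
Proof.
move=> pA; have [sA _] := pA; have uA := pd_unitmx pA.
by rewrite /quad trmx_mul trmx_inv sA mulmxKV// mulmxA.
Qed.

Lemma pd_inv (R : realFieldType) k (A : 'M[R]_k) : pd A -> pd (invmx A).
Proof.
move=> pA; have [sA A0] := pA; split; first by rewrite trmx_inv sA.
move=> v v0; rewrite -quad_inv//; apply: A0; apply: contra_neq v0 => v0.
by rewrite -[v]mul1mx -(mulmxV (pd_unitmx pA)) -mulmxA v0 mulmx0.
Qed.

(** Completing the square: the left side is minimal in [x] at [invmx A *m u], with minimum
    [- quad (invmx A) u]. This identity serves the comparison of inverses, least squares and the
    Gaussian integrals. *)
Lemma quad_compl_sq (R : realFieldType) k (A : 'M[R]_k) (x u : 'cV[R]_k) :
  pd A ->
  quad A x - 2 * (u^T *m x) 0 0 = quad A (x - invmx A *m u) - quad (invmx A) u.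
Proof.
move=> pA; have [sA _] := pA.
have E : (x^T *m A *m (invmx A *m u)) 0 0 = (u^T *m x) 0 0.
  rewrite -mulmxA mulKVmx ?pd_unitmx//.
  by rewrite -[u^T *m x]trmxK trmx_mul trmxK [RHS]mxE.
rewrite quadD// -[- (_ *m _)]scaleN1r quadZr quad_inv// -scalemxAr.
by rewrite [(-1 *: _ : 'M[R]_(_, _)) _ _]mxE E; ring.
Qed.

(** [- quad (invmx A) u] is the minimum over [x] of [quad A x - 2 u'x], which grows with [A]. The
    proof evaluates both functions at the minimizer [invmx P *m u] of the larger one. *)
Lemma quad_inv_le (R : realFieldType) k (A P : 'M[R]_k) u :
  pd A -> pd P -> (forall v, quad A v <= quad P v) ->
  quad (invmx P) u <= quad (invmx A) u.
Proof.
move=> pA pP AP.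
have /eqP := quad_compl_sq (invmx P *m u) u pA.
have /eqP := quad_compl_sq (invmx P *m u) u pP.
rewrite subrr quad0 => /eqP E1 /eqP E2.
have := AP (invmx P *m u); have := pd_ge0 (invmx P *m u - invmx A *m u) pA.
lra.
Qed.

(** * Schur complements and monotonicity of determinants *)

Definition schur (R : realFieldType) k (A : 'M[R]_(1 + k)) : R :=
  (ulsubmx A - ursubmx A *m invmx (drsubmx A) *m dlsubmx A) 0 0.

Lemma det_block_schur (R : realFieldType) m k (A : 'M[R]_m) (B : 'M[R]_(m, k))
    (C : 'M[R]_(k, m)) (D : 'M[R]_k) : D \in unitmx ->
  \det (block_mx A B C D) = \det (A - B *m invmx D *m C) * \det D.
Proof.
move=> uD.
have -> : block_mx A B C D =
    block_mx 1%:M (B *m invmx D) 0 1%:M *m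
    block_mx (A - B *m invmx D *m C) 0 C D.
  by rewrite mulmx_block !mul1mx !mul0mx mulmxKV// !add0r subrK.
by rewrite det_mulmx det_ublock det_lblock !det1 !mul1r.
Qed.

Lemma det_block_schur' (R : realFieldType) m k (A : 'M[R]_m) (B : 'M[R]_(m, k))
    (C : 'M[R]_(k, m)) (D : 'M[R]_k) : A \in unitmx ->
  \det (block_mx A B C D) = \det A * \det (D - C *m invmx A *m B).
Proof.
move=> uA.
have -> : block_mx A B C D =
    block_mx 1%:M 0 (C *m invmx A) 1%:M *m
    block_mx A B 0 (D - C *m invmx A *m B).
  rewrite mulmx_block !mul1mx !mul0mx mulmxKV// !addr0 ?mulmx0 ?addr0.
  by rewrite addrC subrK.
by rewrite det_mulmx det_ublock det_lblock !det1 !mul1r.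
Qed.

Lemma det_schur (R : realFieldType) k (A : 'M[R]_(1 + k)) :
  drsubmx A \in unitmx -> \det A = schur A * \det (drsubmx A).
Proof.
by move=> uD; rewrite -[in LHS](submxK A) det_block_schur// det_mx11.
Qed.

(** Matrix determinant lemma: the determinant of the block matrix with rows [1, -c u'] and [u, A] is
    computed through each of its two Schur complements. *)
Lemma det_outerD (R : realFieldType) k (A : 'M[R]_k) (u : 'cV[R]_k) c :
  A \in unitmx ->
  \det (A + c *: (u *m u^T)) = \det A * (1 + c * quad (invmx A) u).
Proof.
move=> uA.
have := det_block_schur 1%:M (- c *: u^T) u uA.
rewrite det_block_schur' ?unitmx1// det1 mul1r invmx1 mulmx1.
rewrite -!scalemxAr scaleNr opprK => ->; rewrite mulrC; congr (_ * _).
by rewrite det_mx11 -!scalemxAl scaleNr opprK /quad !mxE.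
Qed.

Lemma quad_mx11 (R : realFieldType) (A : 'M[R]_1) x :
  quad A x = A 0 0 * x 0 0 ^+ 2.
Proof. by rewrite /quad mxE big_ord1 mxE big_ord1 mxE expr2; ring. Qed.

(** The square is completed in the lower block [v]; what is left of [x] has the Schur complement as
    coefficient. This drives the inductions on the dimension. *)
Lemma quad_schur (R : realFieldType) k (A : 'M[R]_(1 + k)) (x : 'cV[R]_1) v :
  A^T = A -> drsubmx A \in unitmx ->
  quad A (col_mx x v) = schur A * x 0 0 ^+ 2 +
    quad (drsubmx A) (v + invmx (drsubmx A) *m dlsubmx A *m x).
Proof.
move=> sA uD; have sD : (drsubmx A)^T = drsubmx A by rewrite trmx_drsub sA.
have sB : (dlsubmx A)^T = ursubmx A by rewrite trmx_dlsub sA.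
set D := drsubmx A in uD sD *; set C := dlsubmx A in sB *.
rewrite quadD// -!mulmxA mulKVmx// {1}/quad -[in LHS](submxK A) -/D -/C.
rewrite tr_col_mx mul_row_block mul_row_col -sB.
have -> : quad D (invmx D *m (C *m x)) = quad (C^T *m invmx D *m C) x.
  by rewrite /quad !trmx_mul trmx_inv sD !mulmxA mulmxKV.
have -> : schur A * x 0 0 ^+ 2 =
    quad (ulsubmx A) x - quad (C^T *m invmx D *m C) x.
  by rewrite -quadNl -quadDl quad_mx11 /schur -/C -/D sB.
have addE (M N : 'M[R]_1) : (M + N) 0 0 = M 0 0 + N 0 0 by rewrite mxE.
rewrite !mulmxDl !addE -!/(quad _ _).
have -> : (x^T *m C^T *m v) 0 0 = (v^T *m (C *m x)) 0 0.
  by rewrite -trmx_mul -[in LHS](trmxK v) -trmx_mul mxE.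
by rewrite /quad !mulmxA; ring.
Qed.

Lemma pd_drsubmx (R : realFieldType) k (A : 'M[R]_(1 + k)) :
  pd A -> pd (drsubmx A).
Proof.
case=> sA A0; split; first by rewrite trmx_drsub sA.
move=> v v0; have := A0 (col_mx 0 v).
have -> : quad A (col_mx 0 v) = quad (drsubmx A) v.
  rewrite /quad -[in LHS](submxK A) tr_col_mx mul_row_block mul_row_col.
  by rewrite trmx0 !mul0mx !add0r mulmx0 add0r.
by apply; rewrite col_mx_eq0 negb_and v0 orbT.
Qed.

(** By [quad_schur] this is the minimum of [quad A] over vectors with first coordinate 1, a form in
    which two matrices can be compared. *)
Lemma schurE (R : realFieldType) k (A : 'M[R]_(1 + k)) : pd A ->
  schur A = quad A (col_mx 1%:M (- (invmx (drsubmx A) *m dlsubmx A))).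
Proof.
move=> pA; rewrite quad_schur ?(proj1 pA) ?pd_unitmx//; last exact: pd_drsubmx.
by rewrite mulmx1 addNr quad0 mxE eqxx expr1n mulr1 addr0.
Qed.

Lemma schur_gt0 (R : realFieldType) k (A : 'M[R]_(1 + k)) :
  pd A -> 0 < schur A.
Proof.
move=> pA; rewrite schurE//; apply: (proj2 pA).
by rewrite col_mx_eq0 negb_and; apply/orP; left; apply: matrix_nonzero1.
Qed.

Lemma det_pd_gt0 (R : realFieldType) k (A : 'M[R]_k) : pd A -> 0 < \det A.
Proof.
elim: k A => [|k IH] A pA; first by rewrite det_mx00.
have pD := @pd_drsubmx _ _ (A : 'M[R]_(1 + k)) pA.
by rewrite (det_schur (pd_unitmx pD)) mulr_gt0 ?IH// schur_gt0.
Qed.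

(** Induction through [det_schur]: the Schur complement, being a minimum of the quadratic form, and
    the lower block are both monotone. *)
Lemma det_pd_le (R : realFieldType) k (A P : 'M[R]_k) :
  pd A -> pd P -> (forall v, quad A v <= quad P v) -> \det A <= \det P.
Proof.
elim: k A P => [|k IH] A P pA pP AP; first by rewrite !det_mx00.
have pDA := @pd_drsubmx _ _ (A : 'M[R]_(1 + k)) pA.
have pDP := @pd_drsubmx _ _ (P : 'M[R]_(1 + k)) pP.
rewrite (det_schur (pd_unitmx pDA)) (det_schur (pd_unitmx pDP)).
apply: ler_pM; [exact/ltW/schur_gt0|exact/ltW/det_pd_gt0| |].
  (* Both forms are evaluated at the vector that is minimal for [P]; there [quad A] is [schur A]
     plus a nonnegative term. *)
  rewrite [leRHS]schurE//; apply: le_trans (AP _).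
  rewrite quad_schur ?(proj1 pA) ?pd_unitmx// mxE eqxx expr1n mulr1.
  by rewrite lerDl pd_ge0.
apply: IH => // v; have := AP (col_mx (0 : 'cV_1) v).
rewrite !quad_schur ?(proj1 pA) ?(proj1 pP) ?pd_unitmx//.
by rewrite !mulmx0 !addr0 mxE expr0n /= !mulr0 !add0r.
Qed.

(* Apply monotonicity of the determinant to [Q + t w w'] and [P + t w w'],
   divide by [t] and let [t] tend to infinity. *)
Lemma det_quad_inv_le (R : realFieldType) k (Q P : 'M[R]_k) w :
  pd Q -> pd P -> (forall v, quad Q v <= quad P v) ->
  \det Q * quad (invmx Q) w <= \det P * quad (invmx P) w.
Proof.
move=> pQ pP QP; rewrite leNgt; apply/negP => lt.
pose d := \det Q * quad (invmx Q) w - \det P * quad (invmx P) w.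
have d0 : 0 < d by rewrite subr_gt0.
have dP := det_pd_gt0 pP.
(* One finite value is large enough: with [t * d = \det P], monotonicity of the determinant would
   force [\det Q <= 0]. *)
pose t := \det P / d.
have t0 : 0 < t by rewrite divr_gt0.
have ow (v : 'cV[R]_k) : 0 <= quad (t *: (w *m w^T)) v.
  by rewrite quadZl quad_outer mulr_ge0 ?sqr_ge0 ?ltW.
have sw : (t *: (w *m w^T))^T = t *: (w *m w^T).
  by rewrite linearZ /= outer_sym.
have := det_pd_le (pdD pQ sw ow) (pdD pP sw ow).
have le v : quad (Q + t *: (w *m w^T)) v <= quad (P + t *: (w *m w^T)) v.
  by rewrite !quadDl lerD2r.
move/(_ le); rewrite !det_outerD ?pd_unitmx// !mulrDr !mulr1 => E.
have td : t * d = \det P by rewrite /t divfK// gt_eqF.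
have dQ := det_pd_gt0 pQ.
move: E td; rewrite /d mulrBr ![_ * (t * _)]mulrCA; lra.
Qed.

Lemma quad_schur_sub (R : realFieldType) k (A : 'M[R]_(1 + k))
    (m : 'cV[R]_(1 + k)) (x : R) v :
  A^T = A -> drsubmx A \in unitmx ->
  quad A (col_mx x%:M v - m) =
  quad (drsubmx A)
    (v - (dsubmx m - invmx (drsubmx A) *m dlsubmx A *m (x%:M - usubmx m))) +
  schur A * (x - usubmx m 0 0) ^+ 2.
Proof.
move=> sA uD; rewrite -[in LHS](vsubmxK m) opp_col_mx add_col_mx quad_schur//.
rewrite addrC opprB addrA addrAC; congr (quad _ _ + schur A * _ ^+ 2).
by rewrite [LHS]mxE [x%:M _ _]mxE [(- _ : 'M[R]_(_, _)) _ _]mxE.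
Qed.

(** * Gaussian integrals *)

Section scaling.
Local Open Scope classical_set_scope.
Variable R : realType.
Local Notation mu := (@lebesgue_measure R).

(** By uniqueness of Lebesgue measure it is enough to compare the two measures on the intervals []a,
    b]]. *)
Lemma lebesgue_measure_scale (q : R) (A : set R) : 0 < q -> measurable A ->
  (q%:E * mu [set x | A (q * x)%R])%E = mu A.
Proof.
move=> q0 mA.
pose phi : measurableTypeR R -> measurableTypeR R := *%R q.
have mq : measurable_fun setT phi.
  by apply: continuous_measurable_fun; exact: mulrl_continuous.
pose q' : {nonneg R} := NngNum (ltW q0).
apply/esym.
rewrite (@lebesgue_measure_unique R (mscale q' (pushforward mu phi)))//.
move=> _ [[a b] _ <-]; rewrite /mscale/= /pushforward/=.
change (mu `]a, b] = q%:E * mu ( *%R q @^-1` `]a, b]))%E.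
have -> : *%R q @^-1` `]a, b] = `]a / q, b / q]%classic.
  apply/seteqP; split => x /=; rewrite !in_itv/= ltr_pdivrMr// ler_pdivlMr//;
  by rewrite ![x * q]mulrC.
rewrite !lebesgue_measure_itv/= !lte_fin ltr_pM2r ?invr_gt0//.
case: ifP => _; last by rewrite mule0.
rewrite -!EFinD -EFinM; congr EFin; field.
by rewrite gt_eqF.
Qed.


Lemma ge0_integral_scale (q : R) (f : R -> \bar R) : 0 < q ->
  measurable_fun (`]0, +oo[ : set R) f -> (forall x, 0 < x -> (0 <= f x)%E) ->
  (\int[mu]_(x in `]0%R, +oo[) f x =
   q%:E * \int[mu]_(x in `]0%R, +oo[) f (q * x)%R)%E.
Proof.
move=> q0 mf f0.
pose phi : measurableTypeR R -> measurableTypeR R := *%R q.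
have mq : measurable_fun setT phi.
  by apply: continuous_measurable_fun; exact: mulrl_continuous.
pose q' : {nonneg R} := NngNum (ltW q0).
have [nu nuE] : exists nu : {measure set measurableTypeR R -> \bar R},
    nu = pushforward mu phi :> (set _ -> _).
  by unshelve eexists (pushforward mu phi).
transitivity (\int[mscale q' nu]_(x in `]0%R, +oo[) f x)%E.
  apply: eq_measure_integral => //= A mA _.
  by rewrite /mscale/= nuE lebesgue_measure_scale.
rewrite ge0_integral_mscale//=; last first.
  by move=> x; rewrite in_itv/= andbT; exact: f0.
rewrite nuE ge0_integral_pushforward//=; last first.
  by move=> x; rewrite inE/= in_itv/= andbT; exact: f0.
congr (_ * _)%E; congr (integral _ _ _); apply/seteqP; split => x /=;
  by rewrite !in_itv/= !andbT pmulr_rgt0.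
Qed.
End scaling.

Section gaussian.
Local Open Scope classical_set_scope.
Variable R : realType.
Implicit Types s h c : R.
Local Notation mu := (@lebesgue_measure R).

(** The integrand is a multiple of the normal density with mean [m] and variance [s / h]. The
    constant [c] holds the part of the exponent free of the current variable. *)
Lemma integral_gauss_quad (K s h m c : R) : 0 < s -> 0 < h ->
  (\int[mu]_x (K * expR (- ((h * (x - m) ^+ 2 + c) / (2 * s))))%:E =
   (K * Num.sqrt (2 * pi * s / h) * expR (- (c / (2 * s))))%:E)%E.
Proof.
move=> s0 h0; set sg := Num.sqrt (s / h).
have sg2 : sg ^+ 2 = s / h by rewrite sqr_sqrtr// divr_ge0 ?ltW.
have sgn0 : sg != 0 by rewrite gt_eqF// sqrtr_gt0 divr_gt0.
transitivity (\int[mu]_x ((K * Num.sqrt (2 * pi * s / h) *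
    expR (- (c / (2 * s))))%:E * (normal_pdf m sg x)%:E))%E.
  apply: eq_integral => x _; rewrite -EFinM; congr EFin.
  rewrite normal_pdfE// /normal_peak /normal_fun sg2.
  have -> : s / h * pi *+ 2 = 2 * pi * s / h by rewrite -mulr_natl; ring.
  set w := Num.sqrt _.
  have w0 : w != 0.
    by rewrite gt_eqF// sqrtr_gt0 divr_gt0// mulr_gt0// mulr_gt0 ?pi_gt0.
  have -> : - ((h * (x - m) ^+ 2 + c) / (2 * s)) =
      - (c / (2 * s)) + - (x - m) ^+ 2 / (s / h *+ 2).
    rewrite -mulr_natl; field.
    by rewrite !gt_eqF.
  by rewrite expRD; field.
rewrite integralZl//; last exact: integrable_normal_pdf.
by rewrite integral_normal_pdf mule1.
Qed.

(** Induction along the iterated integral: the inner integral has the lower block of [H], with a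
    centre and a constant that depend on the outer variable, whose own coefficient is the Schur
    complement. *)
Lemma vec_integral_gauss k (H : 'M[R]_k) (m : 'cV[R]_k) (K s c : R) :
  0 < s -> pd H ->
  vec_integral
    (fun v => (K * expR (- ((quad H (v - m) + c) / (2 * s))))%:E) =
  (K * Num.sqrt ((2 * pi * s) ^+ k / \det H) * expR (- (c / (2 * s))))%:E.
Proof.
move=> s0; elim: k H m K c => [|k IH] H m K c pH.
  rewrite /= det_mx00 expr0 divr1 sqrtr1 mulr1.
  by rewrite [0 - m]flatmx0 quad0 add0r.
have pD := @pd_drsubmx _ _ (H : 'M[R]_(1 + k)) pH.
have uD := pd_unitmx pD; have dD := det_pd_gt0 pD.
have sc0 := @schur_gt0 _ _ (H : 'M[R]_(1 + k)) pH.
have dH : \det H =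
    schur (H : 'M[R]_(1 + k)) * \det (drsubmx (H : 'M[R]_(1 + k))).
  exact: (@det_schur _ k (H : 'M[R]_(1 + k)) uD).
rewrite /=.
under eq_integral => x _.
  under [X in vec_integral X]eq_fun => v.
    rewrite (@quad_schur_sub _ k (H : 'M[R]_(1 + k)) m x v (proj1 pH) uD).
    (* The Schur term of the outer variable is regrouped into the constant of the induction
       hypothesis. *)
    rewrite -[X in X / _]addrA.
    over.
  rewrite IH//.
  over.
rewrite integral_gauss_quad//; congr (_ * _)%:E; rewrite -mulrA; congr (_ * _).
have p0 : 0 < 2 * pi * s by rewrite !mulr_gt0 ?pi_gt0.
rewrite -sqrtrM ?divr_ge0 ?exprn_ge0 ?ltW//; congr Num.sqrt.
by rewrite dH exprS; field; rewrite !gt_eqF.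
Qed.


End gaussian.

(** * The integral over the variance *)

Section invgamma.
Local Open Scope classical_set_scope.
Variable R : realType.
Local Notation mu := (@lebesgue_measure R).

(** Up to normalization, the inverse gamma density of shape [m / 2] and scale [Q / 2]. The factor
    [s^-1] is the prior on the variance. *)
Definition invgamma_ker (m : nat) (Q s : R) : R :=
  (Num.sqrt ((2 * pi * s) ^+ m))^-1 * s^-1 * expR (- (Q / (2 * s))).

Lemma invgamma_ker_ge0 m Q s : 0 < s -> 0 <= invgamma_ker m Q s.
Proof.
by move=> s0; rewrite !mulr_ge0 ?expR_ge0// invr_ge0 ?sqrtr_ge0 ?ltW.
Qed.

Lemma invgamma_ker_continuous m Q s : 0 < s ->
  {for s, continuous (invgamma_ker m Q)}.
Proof.
move=> s0; rewrite /prop_for /continuous_at /invgamma_ker.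
have p0 : 0 < 2 * pi * s by rewrite !mulr_gt0 ?pi_gt0.
apply: cvgM.
  apply: cvgM; last by apply: cvgV; [rewrite gt_eqF|exact: cvg_id].
  apply: cvgV; first by rewrite gt_eqF// sqrtr_gt0 exprn_gt0.
  apply: continuous_cvg; first exact: sqrt_continuous.
  apply: (cvg_comp ( *%R (2 * pi)) (fun x : R => x ^+ m)); last first.
    exact: exprn_continuous.
  by apply: cvgM; [exact: cvg_cst|exact: cvg_id].
apply: continuous_cvg; first exact: continuous_expR.
apply: cvgN; apply: cvgM; first exact: cvg_cst.
apply: cvgV; first by rewrite gt_eqF// mulr_gt0.
by apply: cvgM; [exact: cvg_cst|exact: cvg_id].
Qed.

Lemma measurable_invgamma_ker m Q :
  measurable_fun (`]0, +oo[ : set R) (EFin \o invgamma_ker m Q).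
Proof.
apply/measurable_EFinP; apply: open_continuous_measurable_fun.
  exact: interval_open.
by move=> s; rewrite inE/= in_itv/= andbT => /invgamma_ker_continuous; exact.
Qed.

Lemma measurable_invgamma_ker_scale m Q q : 0 < q ->
  measurable_fun (`]0, +oo[ : set R)
    (fun s => (invgamma_ker m Q (q * s))%:E).
Proof.
move=> q0; apply/measurable_EFinP; apply: open_continuous_measurable_fun.
  exact: interval_open.
move=> s; rewrite inE/= in_itv/= andbT => s0.
have := @invgamma_ker_continuous m Q _ (mulr_gt0 q0 s0).
exact: (cvg_comp _ _ (@mulrl_continuous R q s)).
Qed.

Definition invgamma_int m Q : \bar R :=
  (\int[mu]_(s in `]0%R, +oo[) (invgamma_ker m Q s)%:E)%E.

(** The substitution of [Q * s] for [s]. The remaining factor [invgamma_int m 1] is common to all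
    models and cancels in the Bayes factors once it is known to be positive and finite. *)
Lemma invgamma_int_scale m Q : 0 < Q ->
  invgamma_int m Q = ((Num.sqrt (Q ^+ m))^-1%:E * invgamma_int m 1)%E.
Proof.
move=> Q0; rewrite /invgamma_int (ge0_integral_scale Q0); last 2 first.
- exact: measurable_invgamma_ker.
- by move=> s s0; rewrite lee_fin invgamma_ker_ge0.
rewrite -!ge0_integralZl//=; first last.
- by rewrite lee_fin ltW.
- move=> s; rewrite in_itv/= andbT lee_fin => s0.
  by rewrite invgamma_ker_ge0// mulr_gt0.
- exact: measurable_invgamma_ker_scale.
- by move=> s; rewrite in_itv/= andbT lee_fin => /invgamma_ker_ge0.
- exact: measurable_invgamma_ker.
apply: eq_integral => s; rewrite inE/= in_itv/= andbT => s0.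
rewrite -!EFinM; congr EFin; rewrite /invgamma_ker.
have p0 : 0 < 2 * pi * s by rewrite !mulr_gt0 ?pi_gt0.
have -> : 2 * pi * (Q * s) = Q * (2 * pi * s) by ring.
rewrite exprMn sqrtrM ?exprn_ge0 ?ltW//.
have -> : Q / (2 * (Q * s)) = 1 / (2 * s) by field; rewrite !gt_eqF.
field.
by rewrite !gt_eqF// sqrtr_gt0 exprn_gt0.
Qed.

Lemma inv_sqrt_continuous (s : R) : 0 < s ->
  {for s, continuous (fun s : R => s^-1 * (Num.sqrt s)^-1)}.
Proof.
move=> s0; apply: cvgM; first by apply: cvgV; [rewrite gt_eqF|exact: cvg_id].
by apply: cvgV; [rewrite gt_eqF ?sqrtr_gt0|exact: sqrt_continuous].
Qed.

(** The majorant of the kernel at infinity, the power -3/2 of [s], has the antiderivative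
    [- 2 / Num.sqrt s]. *)
Lemma inv_sqrt_lty :
  (\int[mu]_(s in `[1%R, +oo[) (s^-1 * (Num.sqrt s)^-1)%:E < +oo)%E.
Proof.
rewrite (@ge0_continuous_FTC2y R _ (fun s => - (2 * (Num.sqrt s)^-1)) 1
  (- (2 * 0))).
- by rewrite -EFinB ltry.
- by move=> s s1; rewrite mulr_ge0// invr_ge0 ?sqrtr_ge0 ?(le_trans ler01).
- apply: continuous_in_subspaceT => s; rewrite inE/= in_itv/= andbT => s1.
  exact: inv_sqrt_continuous (lt_le_trans ltr01 s1).
- apply: cvgN; apply: cvgM; first exact: cvg_cst.
  apply/gtr0_cvgV0.
    near=> s; rewrite sqrtr_gt0; near: s; apply: nbhs_pinfty_gt; exact: num_real.
  apply/cvgryPge => A; near=> s.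
  have [A0|A0] := leP A 0; first by rewrite (le_trans A0) ?sqrtr_ge0.
  rewrite -(ler_sqr) ?nnegrE ?sqrtr_ge0 ?ltW// sqr_sqrtr; last first.
    near: s; apply: nbhs_pinfty_ge; exact: num_real.
  near: s; apply: nbhs_pinfty_gt; exact: num_real.
- move=> s s1; have s0 : 0 < s := lt_trans ltr01 s1.
  have d := is_derive1_sqrt s0.
  apply/derivableN/derivableM => //.
  apply/derivableV => //; first by rewrite gt_eqF ?sqrtr_gt0.
- apply: cvg_at_right_filter.
  apply: cvgN; apply: cvgM; first exact: cvg_cst.
  by apply: cvgV; [rewrite gt_eqF ?sqrtr_gt0|exact: sqrt_continuous].
- move=> s; rewrite in_itv/= andbT => s1; have s0 : 0 < s := lt_trans ltr01 s1.
  have d := is_derive1_sqrt s0.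
  have sn : Num.sqrt s != 0 by rewrite gt_eqF ?sqrtr_gt0.
  have d' := is_deriveV sn.
  rewrite derive1E derive_val.
  rewrite /GRing.scale/=.
  have s2 : Num.sqrt s ^+ 2 = s by rewrite sqr_sqrtr ?ltW.
  rewrite -[in RHS]s2 sqrtr_sqr ger0_norm ?sqrtr_ge0//; field.
  by rewrite sn.
Unshelve. all: by end_near. Qed.

(** The integral is split at 1. Below 1 the exponential outweighs the negative powers and the kernel
    is bounded; above 1, [m >= 1] and [2 * pi * s >= 1] bound it by the majorant of
    [inv_sqrt_lty]. *)
Lemma invgamma_int_lty m : (0 < m)%N -> (invgamma_int m 1 < +oo)%E.
Proof.
move=> m0; rewrite /invgamma_int.
have piE (s : R) : 0 < s -> s <= 2 * pi * s.
  by move=> s0; have := @pi_ge2 R; nra.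
rewrite (_ : `]0%R, +oo[%classic = `]0%R, 1%R[ `|` `[1%R, +oo[); last first.
  by rewrite -itv_bndbnd_setU// bnd_simp.
rewrite ge0_integral_setU//=; first last.
- apply/disj_setPS => s [] /=; rewrite !in_itv/= andbT => /andP[_ s1] s1'.
  by have := lt_le_trans s1 s1'; rewrite ltxx.
- by move=> s [] /=; rewrite !in_itv/= ?andbT; [move=> /andP[s0 _]|move=> s1];
    rewrite lee_fin invgamma_ker_ge0// (lt_le_trans ltr01).
- apply: measurable_funS (@measurable_invgamma_ker m 1) => //.
  by move=> s [] /=; rewrite !in_itv/= ?andbT;
    [move=> /andP[]|move=> /(lt_le_trans ltr01)].
rewrite lte_add_pinfty//.
(* This constant comes from [x ^+ (m + 1) / (m + 1)! <= expR x] at [x = 1 / (2 * s)]. *)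
- pose C : R := 2 ^+ m.+1 * (m.+1)`!%:R.
  apply: (@le_lt_trans _ _ (\int[mu]_(s in `]0%R, 1%R[) (cst C%:E s))%E);
    last first.
    rewrite integral_cst//= lebesgue_measure_itv/= lte_fin ltr01.
    by rewrite -EFinB -EFinM ltry.
  apply: ge0_le_integral => //=.
  + by move=> s; rewrite in_itv/= => /andP[s0 _]; rewrite lee_fin invgamma_ker_ge0.
  + apply: measurable_funS (@measurable_invgamma_ker m 1) => //.
    by move=> s /=; rewrite !in_itv/= ?andbT => /andP[].
  move=> s; rewrite in_itv/= lee_fin => /andP[s0 s1].
  (* For [s <= 1], [s ^+ 2 <= 2 * pi * s], so the square root can be replaced by an integer power of
     [s]. *)
  have h1 : (Num.sqrt ((2 * pi * s) ^+ m))^-1 <= (s ^+ m)^-1.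
    rewrite lef_pV2 ?posrE ?sqrtr_gt0 ?exprn_gt0// ?(lt_le_trans s0 (piE s s0))//.
    have ps0 := le_trans (ltW s0) (piE s s0).
    rewrite -(ger0_norm (exprn_ge0 m (ltW s0))) -sqrtr_sqr.
    rewrite ler_sqrt ?exprn_ge0//.
    rewrite -exprM mulnC exprM lerXn2r ?nnegrE ?sqr_ge0//.
    by apply: le_trans (piE s s0); nra.
  have h2 : expR (- (1 / (2 * s))) <= C * s ^+ m.+1.
    rewrite expRN -[leRHS]invrK lef_pV2 ?posrE ?expR_gt0//; last first.
      by rewrite invr_gt0 /C !mulr_gt0 ?exprn_gt0// ltr0n fact_gt0.
    have x0 : 0 <= 1 / (2 * s) by rewrite divr_ge0 ?mulr_ge0 ?ltW.
    have := expR_ge1Dxn m x0.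
    apply: le_trans; rewrite ler_wpDl//.
    rewrite /C div1r exprVn exprMn -!invfM [X in X^-1 <= _]mulrAC.
    exact: lexx.
  rewrite /invgamma_ker.
  apply: (@le_trans _ _ ((s ^+ m)^-1 * s^-1 * (C * s ^+ m.+1))).
    apply: ler_pM => //; last by rewrite ler_pM2r ?invr_gt0.
      by rewrite mulr_ge0 ?invr_ge0 ?sqrtr_ge0 ?ltW.
  rewrite exprS le_eqVlt; apply/orP; left; apply/eqP; field.
  by rewrite !gt_eqF ?exprn_gt0.
- apply: le_lt_trans inv_sqrt_lty.
  apply: ge0_le_integral => //=.
  + move=> s; rewrite in_itv/= andbT => s1.
    by rewrite lee_fin invgamma_ker_ge0// (lt_le_trans ltr01).
  + apply: measurable_funS (@measurable_invgamma_ker m 1) => //.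
    by move=> s /=; rewrite !in_itv/= ?andbT; apply: lt_le_trans.
  + apply: (@measurable_funS _ _ _ _ (`]0, +oo[ : set R)) => //.
      by move=> s /=; rewrite !in_itv/= ?andbT; apply: lt_le_trans.
    apply/measurable_EFinP; apply: open_continuous_measurable_fun.
      exact: interval_open.
    by move=> s; rewrite inE/= in_itv/= andbT; exact: inv_sqrt_continuous.
  move=> s; rewrite in_itv/= andbT lee_fin => s1.
  have s0 : 0 < s := lt_le_trans ltr01 s1.
  have p1 : 1 <= 2 * pi * s := le_trans s1 (piE s s0).
  have p0 : 0 < 2 * pi * s := lt_le_trans ltr01 p1.
  rewrite /invgamma_ker -[leRHS]mulr1 [s^-1 * _]mulrC.
  apply: ler_pM; [|exact: expR_ge0| |].
  - by rewrite mulr_ge0 ?invr_ge0 ?sqrtr_ge0 ?ltW.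
  - rewrite ler_pM2r ?invr_gt0// lef_pV2 ?posrE ?sqrtr_gt0 ?exprn_gt0//.
    rewrite ler_sqrt ?exprn_ge0 ?(ltW p0)//; apply: le_trans (piE s s0) _.
    by rewrite -[leLHS]expr1; apply: ler_weXn2l.
  - by rewrite -[leRHS]expR0 ler_expR lerNl oppr0 divr_ge0 ?mulr_ge0 ?ltW.
Qed.

Lemma invgamma_int_gt0 m : (0 < invgamma_int m 1)%E.
Proof.
(* A lower bound of the kernel on [[1, 2]]: the decreasing factors are taken at 2, the increasing
   exponential at 1. *)
pose c := (Num.sqrt ((2 * pi * 2) ^+ m))^-1 * 2^-1 * expR (- (1 / (2 * 1))) : R.
have c0 : 0 < c.
  rewrite !mulr_gt0 ?expR_gt0// invr_gt0 ?sqrtr_gt0// exprn_gt0//.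
  by rewrite !mulr_gt0 ?pi_gt0.
apply: (@lt_le_trans _ _ (\int[mu]_(s in `[1%R, 2%R]) (cst c%:E s))%E).
  rewrite integral_cst//= lebesgue_measure_itv/= lte_fin ltr1n/=.
  by rewrite -EFinB -EFinM lte_fin; move: c0; lra.
apply: (@le_trans _ _ (\int[mu]_(s in `[1%R, 2%R]) (invgamma_ker m 1 s)%:E)%E).
  apply: ge0_le_integral => //=.
  - by move=> *; rewrite lee_fin ltW.
  - apply: measurable_funS (measurable_invgamma_ker m 1) => //.
    by move=> s; rewrite /= !in_itv/= andbT => /andP[+ _]; apply: lt_le_trans.
  move=> s; rewrite in_itv/= lee_fin => /andP[s1 s2].
  have s0 : 0 < s := lt_le_trans ltr01 s1.
  have p0 : 0 < 2 * pi * s by rewrite !mulr_gt0 ?pi_gt0.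
  rewrite /invgamma_ker; apply: ler_pM; [|exact: expR_ge0|apply: ler_pM|].
  - by rewrite mulr_ge0 ?invr_ge0 ?sqrtr_ge0.
  - by rewrite invr_ge0 ?sqrtr_ge0.
  - by rewrite invr_ge0.
  - rewrite lef_pV2 ?posrE ?sqrtr_gt0 ?exprn_gt0 ?mulr_gt0 ?pi_gt0//.
    rewrite ler_sqrt ?exprn_ge0 ?mulr_ge0 ?pi_ge0//.
    rewrite lerXn2r ?nnegrE ?mulr_ge0 ?pi_ge0 ?(ltW s0)//.
    by rewrite ler_pM2l// mulr_gt0 ?pi_gt0.
  - by rewrite lef_pV2 ?posrE.
  - rewrite ler_expR lerN2 !div1r lef_pV2 ?posrE ?mulr_gt0//.
    by rewrite ler_pM2l.
apply: ge0_subset_integral => //=.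
- exact: measurable_invgamma_ker.
- by move=> s; rewrite in_itv/= andbT lee_fin => /invgamma_ker_ge0.
- by move=> s; rewrite /= !in_itv/= andbT => /andP[+ _]; apply: lt_le_trans.
Qed.
End invgamma.

(** * Marginal likelihoods *)

Section least_squares.
Variable R : realType.

Lemma sqnormE k (v : 'cV[R]_k) : sqnorm v = (v^T *m v) 0 0.
Proof. by rewrite mxE; apply: eq_bigr => i _; rewrite mxE expr2. Qed.

Lemma quad_gramE n k (Z : 'M[R]_(n, k)) v : quad (Z^T *m Z) v = sqnorm (Z *m v).
Proof. by rewrite quad_gram. Qed.

Lemma sqnorm_eq0 k (v : 'cV[R]_k) : (sqnorm v == 0) = (v == 0).
Proof.
rewrite psumr_eq0; last by move=> i _; exact: sqr_ge0.
apply/allP/eqP => [h|-> i _]; last by rewrite mxE expr0n eqxx.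
apply/colP => i; rewrite mxE; apply/eqP.
by have := h i (mem_index_enum i); rewrite /= sqrf_eq0.
Qed.

Lemma sqnorm_ge0 k (v : 'cV[R]_k) : 0 <= sqnorm v.
Proof. by apply: sumr_ge0 => i _; exact: sqr_ge0. Qed.

Lemma pd_gram n k (Z : 'M[R]_(n, k)) :
  (forall v : 'cV_k, Z *m v = 0 -> v = 0) -> pd (Z^T *m Z).
Proof.
move=> Z0; split; first by rewrite trmx_mul trmxK.
move=> v v0; rewrite quad_gramE lt_def sqnorm_ge0 andbT sqnorm_eq0.
by apply: contra_neq v0; exact: Z0.
Qed.

Lemma sqnorm_subE n k (Z : 'M[R]_(n, k)) Y c :
  sqnorm (Y - Z *m c) =
  sqnorm Y - 2 * ((Z^T *m Y)^T *m c) 0 0 + quad (Z^T *m Z) c.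
Proof.
rewrite quad_gramE -[in LHS](addrC (- _)) !sqnormE.
have e (v : 'cV[R]_n) : (v^T *m v) 0 0 = quad 1%:M v by rewrite /quad mulmx1.
rewrite !e quadD ?trmx1// -scaleN1r quadZr mulmx1.
rewrite [(-1 *: _)^T]linearZ /= -scalemxAl [(_ *: _ : 'M[R]_(_, _)) _ _]mxE.
have -> : ((Z *m c)^T *m Y) 0 0 = ((Z^T *m Y)^T *m c) 0 0.
  have -> : (Z *m c)^T *m Y = ((Z^T *m Y)^T *m c)^T.
    by rewrite !trmx_mul !trmxK mulmxA.
  by rewrite mxE.
ring.
Qed.

(** Pythagoras for the projection on the columns of [Z]; the last bracket is the residual sum of
    squares. *)
Lemma sqnorm_resid n k (Z : 'M[R]_(n, k)) Y c : pd (Z^T *m Z) ->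
  sqnorm (Y - Z *m c) =
  quad (Z^T *m Z) (c - lsq Z Y) +
  (sqnorm Y - quad (invmx (Z^T *m Z)) (Z^T *m Y)).
Proof.
move=> pG; rewrite sqnorm_subE.
by have := quad_compl_sq c (Z^T *m Y) pG; rewrite -/(lsq Z Y); lra.
Qed.

Lemma SSE_E n k (Z : 'M[R]_(n, k)) Y : pd (Z^T *m Z) ->
  SSE Z Y = sqnorm Y - quad (invmx (Z^T *m Z)) (Z^T *m Y).
Proof. by move=> pG; rewrite /SSE sqnorm_resid// subrr quad0 add0r. Qed.

Lemma SSE_le n k (Z : 'M[R]_(n, k)) Y c : pd (Z^T *m Z) ->
  SSE Z Y <= sqnorm (Y - Z *m c).
Proof. by move=> pG; rewrite SSE_E// sqnorm_resid// lerDr pd_ge0. Qed.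

Lemma quad_block_diag p q (A : 'M[R]_p) (B : 'M[R]_q) u v :
  quad (block_mx A 0 0 B) (col_mx u v) = quad A u + quad B v.
Proof.
rewrite /quad tr_col_mx mul_row_block mul_row_col !mulmx0 addr0 add0r.
by rewrite mxE.
Qed.

(** Orthogonality makes the Gram matrix block diagonal, so the reductions due to [X0] and to [Z] add
    up. *)
Lemma SSE_row n p q (X0 : 'M[R]_(n, p)) (Z : 'M[R]_(n, q)) Y :
  pd (X0^T *m X0) -> pd (Z^T *m Z) -> X0^T *m Z = 0 ->
  SSE (row_mx X0 Z) Y = sqnorm Y - quad (invmx (X0^T *m X0)) (X0^T *m Y)
                       - quad (invmx (Z^T *m Z)) (Z^T *m Y).
Proof.
move=> pG0 pG o.
have o' : Z^T *m X0 = 0 by rewrite -[LHS]trmxK trmx_mul trmxK o trmx0.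
have E : (row_mx X0 Z)^T *m row_mx X0 Z =
    block_mx (X0^T *m X0) 0 0 (Z^T *m Z).
  by rewrite tr_row_mx mul_col_row o o'.
have pE : pd (block_mx (X0^T *m X0) 0 0 (Z^T *m Z)).
  split; first by rewrite -E trmx_mul trmxK.
  move=> v; rewrite -[v]vsubmxK col_mx_eq0 negb_and quad_block_diag.
  move=> /orP[v0|v0].
    by rewrite ltr_pwDl ?pd_ge0// (proj2 pG0).
  by rewrite ltr_wpDl ?pd_ge0// (proj2 pG).
have I : invmx (block_mx (X0^T *m X0) 0 0 (Z^T *m Z)) =
    block_mx (invmx (X0^T *m X0)) 0 0 (invmx (Z^T *m Z)).
  rewrite -[RHS]mul1mx -(mulVmx (pd_unitmx pE)) -mulmxA mulmx_block.
  rewrite !mulmx0 !mul0mx !addr0 !add0r !mulmxV ?pd_unitmx//.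
  by rewrite -scalar_mx_block mulmx1.
rewrite SSE_E E// I tr_row_mx mul_col_mx quad_block_diag; ring.
Qed.

End least_squares.

(** * Integration over the regression coefficients and the variance *)

Section normal.
Local Open Scope classical_set_scope.
Variable R : realType.

Lemma mvnormal_pdf_scalar n (mu Y : 'cV[R]_n) s : 0 < s ->
  mvnormal_pdf mu s%:M Y =
  (Num.sqrt ((2 * pi * s) ^+ n))^-1 * expR (- (sqnorm (Y - mu) / (2 * s))).
Proof.
move=> s0; rewrite /mvnormal_pdf det_scalar -exprMn invmx_scalar mul_mx_scalar.
rewrite -scalemxAl mxE -sqnormE; congr (_ * expR (- _)).
by field; rewrite gt_eqF.
Qed.

Lemma mvnormal_pdf_cov k (W : 'M[R]_k) b s : 0 < s -> pd W ->
  mvnormal_pdf 0 (s *: W) b =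
  (Num.sqrt ((2 * pi * s) ^+ k * \det W))^-1 *
  expR (- (quad (invmx W) b / (2 * s))).
Proof.
move=> s0 pW; rewrite /mvnormal_pdf detZ mulrA -exprMn subr0.
rewrite invmxZ; last by rewrite pd_unitmx//; exact: pdZ.
rewrite -/(quad _ _) quadZl; congr (_ * expR (- _)).
by field; rewrite gt_eqF.
Qed.

Variables (n p0 k m : nat).
Variables (X0 : 'M[R]_(n, p0)) (Z : 'M[R]_(n, k)) (Y : 'cV[R]_n).
Hypothesis nE : n = (m + p0)%N.
Hypothesis pG0 : pd (X0^T *m X0).
Hypothesis o : X0^T *m Z = 0.

Let T := sqnorm Y - quad (invmx (X0^T *m X0)) (X0^T *m Y).

Lemma vec_integral_null s : 0 < s ->
  vec_integral (fun b0 : 'cV[R]_p0 =>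
    (mvnormal_pdf (X0 *m b0) s%:M Y * s^-1)%:E) =
  ((Num.sqrt (\det (X0^T *m X0)))^-1 * invgamma_ker m T s)%:E.
Proof.
move=> s0.
have a0 : 0 < 2 * pi * s by rewrite !mulr_gt0 ?pi_gt0.
have En : (2 * pi * s) ^+ n = (2 * pi * s) ^+ m * (2 * pi * s) ^+ p0.
  by rewrite -exprD -nE.
under [X in vec_integral X]eq_fun => b0.
  rewrite mvnormal_pdf_scalar// sqnorm_resid// mulrAC.
  over.
rewrite vec_integral_gauss//; congr EFin.
rewrite /invgamma_ker En !sqrtrM ?exprn_ge0 ?ltW// sqrtrV ?ltW ?det_pd_gt0//.
field.
by rewrite !gt_eqF// sqrtr_gt0 ?exprn_gt0// det_pd_gt0.
Qed.

(** The power of [2 * pi * s] in the prior density of [b] cancels the one produced by integrating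
    [b], and integrating [b0] removes [p0] factors. So the exponent is [m], as for the null model,
    whatever [k] is. *)
Lemma vec_integral_model (W : 'M[R]_k) s : 0 < s -> pd W -> pd (Z^T *m Z) ->
  vec_integral (fun b0 : 'cV[R]_p0 =>
    vec_integral (fun b : 'cV[R]_k =>
      (mvnormal_pdf (X0 *m b0 + Z *m b) s%:M Y *
       mvnormal_pdf 0 (s *: W) b * s^-1)%:E)) =
  ((Num.sqrt (\det W * \det (Z^T *m Z + invmx W) * \det (X0^T *m X0)))^-1 *
   invgamma_ker m (T - quad (invmx (Z^T *m Z + invmx W)) (Z^T *m Y)) s)%:E.
Proof.
move=> s0 pW pG; set H := Z^T *m Z + invmx W.
have pH : pd H.
  have pW' := pd_inv pW.
  by apply: pdD => //; [exact: (proj1 pW')|move=> v; exact: pd_ge0].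
have a0 : 0 < 2 * pi * s by rewrite !mulr_gt0 ?pi_gt0.
have En : (2 * pi * s) ^+ n = (2 * pi * s) ^+ m * (2 * pi * s) ^+ p0.
  by rewrite -exprD -nE.
have dW := det_pd_gt0 pW; have dH := det_pd_gt0 pH; have dG := det_pd_gt0 pG0.
(* Since [X0^T *m Z = 0], the centre [lsq X0 Y] of the square in [b0] does not depend on [b], and
   the two integrals separate. *)
have E b0 b : sqnorm (Y - (X0 *m b0 + Z *m b)) + quad (invmx W) b =
    quad H (b - invmx H *m (Z^T *m Y)) +
    (quad (X0^T *m X0) (b0 - lsq X0 Y) + (T - quad (invmx H) (Z^T *m Y))).
  rewrite opprD addrA addrAC sqnorm_resid// /lsq mulmxBr mulmxA o mul0mx subr0.
  rewrite -/(lsq X0 Y) sqnorm_subE.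
  have := quad_compl_sq b (Z^T *m Y) pH; rewrite {1}/H quadDl /T; lra.
under [X in vec_integral X]eq_fun => b0.
  under [X in vec_integral X]eq_fun => b.
    rewrite mvnormal_pdf_scalar// mvnormal_pdf_cov// mulrACA -expRD -opprD.
    rewrite -mulrDl E [_ * expR _ * s^-1]mulrAC.
    over.
  rewrite vec_integral_gauss//.
  over.
rewrite vec_integral_gauss//; congr EFin.
rewrite /invgamma_ker En !sqrtrM ?exprn_ge0 ?(ltW a0) ?mulr_ge0 ?ltW//.
rewrite !sqrtrV ?ltW//.
field.
by rewrite !gt_eqF// sqrtr_gt0 ?exprn_gt0.
Qed.

Lemma integral_invgamma_ker (c Q : R) (f : R -> \bar R) :
  (0 < m)%N -> 0 <= c -> 0 < Q ->
  (forall s, 0 < s -> f s = (c * invgamma_ker m Q s)%:E) ->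
  (\int[@lebesgue_measure R]_(s in `]0%R, +oo[) f s)%E =
  (c * (Num.sqrt (Q ^+ m))^-1 * fine (invgamma_int m (1 : R)))%:E.
Proof.
move=> m0 c0 Q0 fE.
transitivity (\int[@lebesgue_measure R]_(s in `]0%R, +oo[)
    (c%:E * (invgamma_ker m Q s)%:E))%E.
  by apply: eq_integral => s; rewrite inE/= in_itv/= andbT => /fE ->.
rewrite ge0_integralZl//=; first last.
- by move=> s; rewrite in_itv/= andbT lee_fin => /invgamma_ker_ge0.
- exact: measurable_invgamma_ker.
rewrite -/(invgamma_int m Q) invgamma_int_scale//.
have fi : invgamma_int m (1 : R) \is a fin_num.
  by rewrite ge0_fin_numE ?invgamma_int_lty// ltW// invgamma_int_gt0.
by rewrite -{1}(fineK fi) -!EFinM mulrA.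
Qed.

End normal.

(** * Covariances above the lower bound *)

Section covariance.
Variables (R : realType) (k : nat) (G : 'M[R]_k).
Hypothesis pG : pd G.

(** Woodbury identity, checked by multiplying out after rewriting the right side as [W P^-1 G^-1]
    with [P = G^-1 + W]. *)
Lemma invmx_add_inv W : pd W ->
  invmx (G + invmx W) =
  invmx G - invmx G *m invmx (invmx G + W) *m invmx G.
Proof.
move=> pW; have uW := pd_unitmx pW; have uG := pd_unitmx pG.
have pP : pd (invmx G + W).
  by apply: pdD (pd_inv pG) (proj1 pW) _ => v; exact: pd_ge0.
have E : (G + invmx W) *m
    (invmx G - invmx G *m invmx (invmx G + W) *m invmx G) = 1%:M.
  have -> : invmx G - invmx G *m invmx (invmx G + W) *m invmx G =
      W *m invmx (invmx G + W) *m invmx G.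
    have {1}-> : invmx G = (invmx G + W) *m invmx (invmx G + W) *m invmx G.
      by rewrite mulmxV ?pd_unitmx// mul1mx.
    by rewrite -mulmxBl -mulmxBl addrC addKr.
  rewrite !mulmxA mulmxDl mulVmx//.
  have -> : G *m W + 1%:M = G *m (invmx G + W).
    by rewrite mulmxDr mulmxV// addrC.
  by rewrite -[G *m _ *m _]mulmxA mulmxV ?pd_unitmx// mulmx1 mulmxV.
have uH := proj1 (mulmx1_unit E).
by rewrite -[RHS]mul1mx -(mulVmx uH) -mulmxA E mulmx1.
Qed.

Lemma quad_addmx_inv_inv W z : pd W ->
  quad (invmx (G + invmx W)) z =
  quad (invmx G) z - quad (invmx (invmx G + W)) (invmx G *m z).
Proof.
move=> pW; rewrite invmx_add_inv// quadDl quadNl; congr (_ - _).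
by rewrite /quad trmx_mul trmx_inv (proj1 pG) !mulmxA.
Qed.

Lemma det_addmx_inv W : pd W ->
  \det W * \det (G + invmx W) = \det (invmx G + W) * \det G.
Proof.
move=> pW; rewrite -!det_mulmx mulmxDl mulmxDr mulVmx ?pd_unitmx//.
by rewrite mulmxV ?pd_unitmx// addrC.
Qed.

Variables (N : R).
Hypothesis N1 : 1 < N.

Let N0 : 0 < N. Proof. exact: lt_trans ltr01 N1. Qed.
Let pQ : pd (N *: invmx G). Proof. exact: pdZ (pd_inv pG). Qed.

(** Used with [N = n + 1], where it is the constraint of the restricted ML prior. In terms of
    [P = G^-1 + W] it reads [P >= N G^-1]. *)
Definition admissible (W : 'M[R]_k) := psd (W - (N - 1) *: invmx G).

Lemma admissible_pd W : admissible W -> pd W.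
Proof.
move=> [sW W0]; rewrite -[W](subrK ((N - 1) *: invmx G)) addrC.
by apply: pdD => //; apply: pdZ (pd_inv pG); rewrite subr_gt0.
Qed.

Let addE W : invmx G + W = N *: invmx G + (W - (N - 1) *: invmx G).
Proof.
rewrite scalerBl scale1r opprB addrC [RHS]addrCA; congr (_ + _).
by rewrite [invmx G - _]addrC addNKr.
Qed.

Lemma quad_invQ w : quad (invmx (N *: invmx G)) w = quad G w / N.
Proof. by rewrite invmxZ ?pd_unitmx// quadZl invmxK mulrC. Qed.

Lemma detQ : \det (N *: invmx G) = N ^+ k / \det G.
Proof. by rewrite detZ det_inv. Qed.

(** With [w = u], this is the scalar [a] of the opening comment, the factor multiplying R^2 in the
    residual term. *)
Definition rayleigh W w := quad (invmx (invmx G + W)) w / quad G w.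

(** All bounds compare [P = G^-1 + W] with [Q = N G^-1 <= P], where [Q^-1 = G / N]: the second is
    order reversal of inverses, the third is [det_quad_inv_le]. *)
Lemma rayleigh_bound W w : admissible W -> w != 0 ->
  [/\ 0 < rayleigh W w, rayleigh W w <= N^-1 &
      N ^+ k / N <= \det (invmx G + W) * \det G * rayleigh W w].
Proof.
move=> aW w0; have pW := admissible_pd aW.
have gw : 0 < quad G w := proj2 pG w w0.
have pP : pd (invmx G + W).
  by apply: pdD (pd_inv pG) (proj1 pW) _ => v; exact: pd_ge0.
have le v : quad (N *: invmx G) v <= quad (invmx G + W) v.
  by rewrite addE [leRHS]quadDl lerDl (proj2 aW).
split.
- by rewrite divr_gt0// (proj2 (pd_inv pP)).
- rewrite ler_pdivrMr// mulrC -quad_invQ.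
  exact: quad_inv_le.
- have := det_quad_inv_le w pQ pP le; rewrite quad_invQ detQ.
  have dG := det_pd_gt0 pG.
  move=> h; rewrite /rayleigh [leRHS]mulrA ler_pdivlMr//.
  rewrite -(ler_pM2r (_ : 0 < (\det G)^-1)) ?invr_gt0//.
  have -> : \det (invmx G + W) * \det G * quad (invmx (invmx G + W)) w /
      \det G = \det (invmx G + W) * quad (invmx (invmx G + W)) w.
    by field; rewrite gt_eqF.
  apply: le_trans h; rewrite le_eqVlt; apply/orP; left; apply/eqP; ring.
Qed.

Lemma rayleigh_attained w a : w != 0 -> 0 < a -> a <= N^-1 ->
  exists W, [/\ admissible W, rayleigh W w = a &
    \det (invmx G + W) * \det G * a = N ^+ k / N].
Proof.
move=> w0 a0 aN; have gw : 0 < quad G w := proj2 pG w w0.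
have dG := det_pd_gt0 pG.
(* Solves [1 + c * (quad G w / N) = (N * a)^-1], the factor by which the rank-one term multiplies
   the determinant; [a <= N^-1] makes it nonnegative. *)
pose c := ((N * a)^-1 - 1) * N / quad G w.
have Na : 1 <= (N * a)^-1.
  by rewrite invf_ge1 ?mulr_gt0// -(mulfV (lt0r_neq0 N0)) ler_pM2l.
have c0 : 0 <= c.
  by rewrite divr_ge0 ?(ltW gw)// mulr_ge0 ?(ltW N0)// subr_ge0.
pose W := (N - 1) *: invmx G + c *: (w *m w^T).
have WE : W - (N - 1) *: invmx G = c *: (w *m w^T) by rewrite addrC addKr.
have aW : admissible W.
  split; first by rewrite WE linearZ /= outer_sym.
  by move=> v; rewrite WE -/(quad _ _) quadZl quad_outer mulr_ge0 ?sqr_ge0.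
have pW := admissible_pd aW.
have pP : pd (invmx G + W).
  by apply: pdD (pd_inv pG) (proj1 pW) _ => v; exact: pd_ge0.
have PE : invmx G + W = N *: invmx G + c *: (w *m w^T) by rewrite addE WE.
have cE : 1 + c * (quad G w / N) = (N * a)^-1.
  by rewrite /c; field; rewrite !gt_eqF.
exists W; split => //.
  (* [w] is an eigenvector of [P Q^-1] with [P = G^-1 + W] and [Q = N G^-1]; inverting gives
     [P^-1 w = N a Q^-1 w], hence the Rayleigh quotient. *)
  have E : (invmx G + W) *m (invmx (N *: invmx G) *m w) = (N * a)^-1 *: w.
    have q : w^T *m (invmx (N *: invmx G) *m w) = (quad G w / N)%:M.
      by rewrite mulmxA [LHS]mx11_scalar -quad_invQ.
    rewrite PE mulmxDl mulKVmx ?pd_unitmx// -scalemxAl -mulmxA q.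
    by rewrite mul_mx_scalar scalerA -cE scalerDl scale1r.
  have {}E : invmx (invmx G + W) *m w = (N * a) *: (invmx (N *: invmx G) *m w).
    apply: (can_inj (mulKmx (pd_unitmx pP))).
    rewrite mulKVmx ?pd_unitmx// -scalemxAr E scalerA mulfV ?scale1r//.
    by rewrite mulf_neq0 ?gt_eqF.
  rewrite /rayleigh {1}/quad -mulmxA E -scalemxAr mxE mulmxA.
  rewrite -/(quad (invmx (N *: invmx G)) w) quad_invQ.
  by field; rewrite !gt_eqF.
rewrite PE det_outerD ?pd_unitmx// detQ quad_invQ cE.
by field; rewrite !gt_eqF.
Qed.

End covariance.

(** * Scalar inequalities *)

Section scalar.
Local Open Scope classical_set_scope.
Variable R : realType.
Implicit Types N r a b : R.

Definition bf_sq (k m : nat) N r a : R :=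
  N * a / (N ^+ k * (1 - r + a * r) ^+ m).

Lemma bf_den_gt0 r a : 0 <= r -> r < 1 -> 0 <= a -> 0 < 1 - r + a * r.
Proof. by move=> r0 r1 a0; rewrite ltr_pwDl ?subr_gt0// mulr_ge0. Qed.

Lemma bf_sq_gt0 k m N r a : 0 < N -> 0 <= r -> r < 1 -> 0 < a ->
  0 < bf_sq k m N r a.
Proof.
move=> N0 r0 r1 a0.
by rewrite divr_gt0 ?mulr_gt0 ?exprn_gt0 ?bf_den_gt0// ltW.
Qed.

(** The extreme value theorem on the closed interval from 0 to [N^-1]; the function vanishes at 0
    and is positive at [N^-1], so the maximizer is not 0. *)
Lemma bf_sq_argmax k m N r : 0 < N -> 0 <= r -> r < 1 ->
  exists a, [/\ 0 < a, a <= N^-1 &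
    forall a', 0 < a' -> a' <= N^-1 -> bf_sq k m N r a' <= bf_sq k m N r a].
Proof.
move=> N0 r0 r1.
have Ni0 : 0 < N^-1 by rewrite invr_gt0.
have cf : {within `[0, N^-1], continuous (bf_sq k m N r)}.
  apply: continuous_in_subspaceT => a; rewrite inE/= in_itv/= => /andP[a0 _].
  have d0 := bf_den_gt0 r0 r1 a0.
  apply: cvgM; first by apply: cvgM; [exact: cvg_cst|exact: cvg_id].
  apply: cvgV; first by rewrite gt_eqF// mulr_gt0 ?exprn_gt0.
  apply: cvgM; first exact: cvg_cst.
  apply: (cvg_comp (fun a => 1 - r + a * r) (fun x : R => x ^+ m)).
    apply: cvgD; first exact: cvg_cst.
    by apply: cvgM; [exact: cvg_id|exact: cvg_cst].
  exact: exprn_continuous.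
have [a] := EVT_max (ltW Ni0) cf.
rewrite in_itv/= => /andP[a0 aN] amax; exists a; split => //.
- rewrite lt_def a0 andbT; apply/eqP => aE.
  have := amax N^-1; rewrite in_itv/= lexx ltW// => /(_ isT).
  rewrite aE {2}/bf_sq mulr0 mul0r.
  by rewrite leNgt bf_sq_gt0.
- by move=> a' a'0 a'N; apply: amax; rewrite in_itv/= a'N ltW.
Qed.

(** Numerators and powers of [N] agree on both sides, and the two products of denominator bases
    differ by exactly [(rJ - rI) * (b - a)]. *)
Lemma bf_sq_cross kI kJ m N rI rJ a b :
  0 < N -> 0 <= rI -> rI <= rJ -> rJ < 1 -> 0 < a -> a <= b ->
  bf_sq kJ m N rJ b * bf_sq kI m N rI a <=
  bf_sq kJ m N rJ a * bf_sq kI m N rI b.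
Proof.
move=> N0 rI0 rIJ rJ1 a0 ab.
have b0 := lt_le_trans a0 ab.
have rI1 := le_lt_trans rIJ rJ1; have rJ0 := le_trans rI0 rIJ.
have E r s x y : bf_sq kJ m N r x * bf_sq kI m N s y =
   N * x * (N * y) / (N ^+ kJ * N ^+ kI *
     ((1 - r + x * r) * (1 - s + y * s)) ^+ m).
  by rewrite /bf_sq exprMn mulrACA -invfM; congr (_ * _^-1); ring.
have dJa := bf_den_gt0 rJ0 rJ1 (ltW a0); have dIa := bf_den_gt0 rI0 rI1 (ltW a0).
have dJb := bf_den_gt0 rJ0 rJ1 (ltW b0); have dIb := bf_den_gt0 rI0 rI1 (ltW b0).
have Nk k : 0 < N ^+ k by rewrite exprn_gt0.
rewrite !E [N * b * _]mulrC ler_pM2l ?mulr_gt0//.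
rewrite lef_pV2 ?posrE ?mulr_gt0// ?exprn_gt0 ?mulr_gt0//.
rewrite ler_pM2l ?mulr_gt0// lerXn2r ?nnegrE ?mulr_ge0
  ?(ltW dJa) ?(ltW dIa) ?(ltW dJb) ?(ltW dIb)//.
have : 0 <= (rJ - rI) * (b - a) by rewrite mulr_ge0 ?subr_ge0.
nra.
Qed.

Definition bic_sq (k n : nat) r : R := (n%:R ^+ k * (1 - r) ^+ n)^-1.

(** Splitting the exponent [n = m + p0] leaves three separate comparisons: [n <= N] raised to
    [kJ - kI], a product of bases with difference [a * (rJ - rI)] raised to [m], and
    [1 - rJ <= 1 - rI] raised to [p0]. *)
Lemma bic_sq_cross kI kJ m p0 rI rJ a : let n := (m + p0)%N in
  (0 < n)%N -> (kI <= kJ)%N -> 0 <= rI -> rI <= rJ -> rJ < 1 -> 0 < a ->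
  bf_sq kJ m n.+1%:R rJ a * bic_sq kI n rI <=
  bic_sq kJ n rJ * bf_sq kI m n.+1%:R rI a.
Proof.
move=> n n0 kIJ rI0 rIJ rJ1 a0.
have rI1 := le_lt_trans rIJ rJ1; have rJ0 := le_trans rI0 rIJ.
have dJ := bf_den_gt0 rJ0 rJ1 (ltW a0); have dI := bf_den_gt0 rI0 rI1 (ltW a0).
set N : R := n.+1%:R; have N0 : 0 < N by rewrite ltr0n.
have n0' : 0 < n%:R :> R by rewrite ltr0n.
have nN : n%:R <= N by rewrite ler_nat.
have sI : 0 < 1 - rI by rewrite subr_gt0.
have sJ : 0 < 1 - rJ by rewrite subr_gt0.
rewrite [leRHS]mulrC /bf_sq /bic_sq -!mulrA -!invfM.
rewrite ler_pM2l// ler_pM2l// lef_pV2 ?posrE ?mulr_gt0 ?exprn_gt0//.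
have -> : N ^+ kI * (1 - rI + a * rI) ^+ m * (n%:R ^+ kJ * (1 - rJ) ^+ n) =
   (N ^+ kI * n%:R ^+ kJ) *
   (((1 - rJ) * (1 - rI + a * rI)) ^+ m * (1 - rJ) ^+ p0).
  by rewrite [(1 - rJ) ^+ n]exprD exprMn; ring.
have -> : N ^+ kJ * (1 - rJ + a * rJ) ^+ m * (n%:R ^+ kI * (1 - rI) ^+ n) =
   (N ^+ kJ * n%:R ^+ kI) *
   (((1 - rI) * (1 - rJ + a * rJ)) ^+ m * (1 - rI) ^+ p0).
  by rewrite [(1 - rI) ^+ n]exprD exprMn; ring.
apply: ler_pM.
- by rewrite mulr_ge0 ?exprn_ge0 ?ltW.
- by rewrite mulr_ge0 ?exprn_ge0 ?mulr_ge0 ?(ltW sJ) ?(ltW dI).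
- rewrite -(subnK kIJ) !exprD.
  rewrite [leLHS]mulrCA [leRHS]mulrAC -mulrA [X in _ <= _ * X]mulrC.
  rewrite ler_pM2r; last by rewrite mulr_gt0 ?exprn_gt0.
  by rewrite lerXn2r ?nnegrE ?(ltW N0) ?(ltW n0').
- apply: ler_pM; rewrite ?exprn_ge0 ?mulr_ge0 ?(ltW sJ) ?(ltW dI)//.
    rewrite lerXn2r ?nnegrE ?mulr_ge0 ?(ltW sJ) ?(ltW dI) ?(ltW sI) ?(ltW dJ)//.
    have : 0 <= a * (rJ - rI) by rewrite mulr_ge0 ?subr_ge0 ?(ltW a0).
    nra.
  by rewrite lerXn2r ?nnegrE ?(ltW sJ) ?(ltW sI)// lerD2l lerN2.
Qed.

Lemma powR_half (x : R) k : 0 <= x ->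
  x `^ (- (k%:R / 2)) = (Num.sqrt (x ^+ k))^-1.
Proof.
by move=> x0; rewrite powRN powRrM powR_mulrn// powR12_sqrt// exprn_ge0.
Qed.

End scalar.

(** * Nested models *)

Section design.
Variable R : realType.

Definition full_col n k (A : 'M[R]_(n, k)) :=
  forall v : 'cV[R]_k, A *m v = 0 -> v = 0.

Lemma full_col_row_free n k (A : 'M[R]_(n, k)) : row_free A^T -> full_col A.
Proof.
move=> fA v Av; apply: trmx_inj; rewrite trmx0; apply/eqP.
by rewrite -(mulmx_free_eq0 _ fA) -trmx_mul Av trmx0.
Qed.

Lemma colsubE n k l (f : 'I_l -> 'I_k) (A : 'M[R]_(n, k)) :
  colsub f A = A *m colsub f 1%:M.
Proof. by rewrite mulmx_colsub mulmx1. Qed.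

Lemma full_col_colsub n k l (f : 'I_l -> 'I_k) (A : 'M[R]_(n, k)) :
  injective f -> full_col A -> full_col (colsub f A).
Proof.
move=> fi fA v; rewrite colsubE -mulmxA => /fA v0.
apply/colP => j; have /colP/(_ (f j)) := v0.
rewrite !mxE (bigD1 j)//= !mxE eqxx mul1r big1 ?addr0// => i ij.
by rewrite !mxE (inj_eq fi) eq_sym (negbTE ij) mul0r.
Qed.

Lemma full_col_row n p q (A : 'M[R]_(n, p)) (B : 'M[R]_(n, q)) :
  full_col (row_mx A B) -> full_col A /\ full_col B.
Proof.
move=> f; split=> v v0.
  have := f (col_mx v 0); rewrite mul_row_col v0 mulmx0 addr0.
  by move=> /(_ erefl)/eqP; rewrite col_mx_eq0 => /andP[/eqP].
have := f (col_mx 0 v); rewrite mul_row_col v0 mulmx0 addr0.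
by move=> /(_ erefl)/eqP; rewrite col_mx_eq0 => /andP[_ /eqP].
Qed.

Lemma full_col_row_orth n p q (A : 'M[R]_(n, p)) (B : 'M[R]_(n, q)) :
  A^T *m B = 0 -> full_col A -> full_col B -> full_col (row_mx A B).
Proof.
move=> o fA fB v; rewrite -[v]vsubmxK mul_row_col => E.
have a0 : usubmx v = 0.
  apply/eqP/negPn/negP => /(proj2 (pd_gram fA)).
  rewrite /quad -mulmxA -[A^T *m A *m _]mulmxA.
  have -> : A *m usubmx v = - (B *m dsubmx v).
    by apply/eqP; rewrite -subr_eq0 opprK E.
  by rewrite mulmxN mulmxA o mul0mx oppr0 mulmx0 mxE ltxx.
move: E; rewrite a0 mulmx0 add0r => /fB ->.
by rewrite col_mx0.
Qed.

(** A fit on selected columns is also a linear combination of all the columns, so it cannot beat the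
    least-squares optimum over all of them. *)
Lemma SSE_row_colsub n p k l (X0 : 'M[R]_(n, p)) (f : 'I_l -> 'I_k)
    (A : 'M[R]_(n, k)) Y : full_col (row_mx X0 A) ->
  SSE (row_mx X0 A) Y <= SSE (row_mx X0 (colsub f A)) Y.
Proof.
move=> fA; rewrite [leRHS]/SSE.
have -> : row_mx X0 (colsub f A) =
    row_mx X0 A *m block_mx 1%:M 0 0 (colsub f 1%:M).
  by rewrite mul_row_block !mulmx1 !mulmx0 addr0 add0r -colsubE.
by rewrite -mulmxA; apply: SSE_le; exact: pd_gram.
Qed.

Lemma design_sub n p (X : 'M[R]_(n, p)) (I J : {set 'I_p}) : I \subset J ->
  exists f, design X I = colsub f (design X J).
Proof.
move=> /fintype.subsetP IJ.
have h (i : 'I_#|I|) : enum_val i \in J by apply: IJ; exact: enum_valP.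
exists (fun i => enum_rank_in (h i) (enum_val i)).
by apply/matrixP => i j; rewrite !mxE enum_rankK_in// h.
Qed.
End design.

(** * Bayes factors of the models as scalar functions *)

Section models.
Local Open Scope classical_set_scope.
Variables (R : realType) (n p0 p : nat).
Variables (X0 : 'M[R]_(n, p0)) (X : 'M[R]_(n, p)) (Y : 'cV[R]_n).
Hypothesis hfree : row_free (row_mx X0 X)^T.
Hypothesis horth : X0^T *m X = 0.
Hypothesis hn : (p + p0 < n)%N.
Hypothesis hSSE : 0 < SSE (row_mx X0 X) Y.

Let fX : full_col (row_mx X0 X). Proof. exact: full_col_row_free. Qed.
Let pG0 : pd (X0^T *m X0).
Proof. by apply: pd_gram; have [] := full_col_row fX. Qed.

Lemma full_col_design (S : {set 'I_p}) : full_col (design X S).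
Proof.
by apply: full_col_colsub; [exact: enum_val_inj|have [] := full_col_row fX].
Qed.

Lemma pd_design (S : {set 'I_p}) : pd ((design X S)^T *m design X S).
Proof. by apply: pd_gram; exact: full_col_design. Qed.

Lemma design_orth (S : {set 'I_p}) : X0^T *m design X S = 0.
Proof. by rewrite /design colsubE mulmxA horth mul0mx. Qed.

Lemma full_col_model (S : {set 'I_p}) : full_col (row_mx X0 (design X S)).
Proof.
apply: full_col_row_orth.
- exact: design_orth.
- by have [] := full_col_row fX.
- exact: full_col_design.
Qed.

Let T := sqnorm (Y - X0 *m lsq X0 Y).
Let z (S : {set 'I_p}) := (design X S)^T *m Y.
Let G (S : {set 'I_p}) := (design X S)^T *m design X S.
Let m := (n - p0)%N.

Let TE : T = sqnorm Y - quad (invmx (X0^T *m X0)) (X0^T *m Y).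
Proof. exact: SSE_E. Qed.

Lemma SSE_modelE (S : {set 'I_p}) :
  SSE (row_mx X0 (design X S)) Y = T - quad (invmx (G S)) (z S).
Proof. by rewrite SSE_row ?TE//; [exact: pd_design|exact: design_orth]. Qed.

Lemma SSE_model_gt0 (S : {set 'I_p}) : 0 < SSE (row_mx X0 (design X S)) Y.
Proof. by apply: lt_le_trans hSSE _; exact: SSE_row_colsub. Qed.

Let T0 : 0 < T.
Proof.
have := SSE_model_gt0 finset.set0; rewrite SSE_modelE.
have := pd_ge0 (z finset.set0) (pd_inv (pd_design finset.set0)).
rewrite -/(G _); lra.
Qed.

Lemma RsqE (S : {set 'I_p}) : Rsq X0 X Y S * T = quad (invmx (G S)) (z S).
Proof.
by rewrite /Rsq -/T SSE_modelE; field; rewrite gt_eqF.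
Qed.

Lemma Rsq_ge0 (S : {set 'I_p}) : 0 <= Rsq X0 X Y S.
Proof.
by rewrite -(pmulr_lge0 _ T0) RsqE pd_ge0//; apply: pd_inv; exact: pd_design.
Qed.

Lemma Rsq_lt1 (S : {set 'I_p}) : Rsq X0 X Y S < 1.
Proof. by rewrite ltrBlDr ltrDl divr_gt0 ?SSE_model_gt0. Qed.

Lemma Rsq_le (I J : {set 'I_p}) : I \subset J -> Rsq X0 X Y I <= Rsq X0 X Y J.
Proof.
move=> /(design_sub X)[f E]; rewrite lerD2l lerN2 ler_pM2r ?invr_gt0//.
rewrite E; apply: SSE_row_colsub; exact: full_col_model.
Qed.

Let nE : n = (m + p0)%N.
Proof. by rewrite subnK// (leq_trans _ (ltnW hn))// leq_addl. Qed.

Let m0 : (0 < m)%N.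
Proof. by rewrite subn_gt0 (leq_ltn_trans _ hn)// leq_addl. Qed.

Let nullC : R := (Num.sqrt (\det (X0^T *m X0)))^-1 * (Num.sqrt (T ^+ m))^-1 *
  fine (invgamma_int m (1 : R)).

Let nullC_gt0 : 0 < nullC.
Proof.
rewrite !mulr_gt0 ?invr_gt0 ?sqrtr_gt0 ?exprn_gt0 ?det_pd_gt0//.
by rewrite fine_gt0// invgamma_int_gt0 invgamma_int_lty.
Qed.

Lemma marginal_nullE : marginal_null X0 Y = nullC%:E.
Proof.
apply: integral_invgamma_ker => //.
by move=> s s0; rewrite (vec_integral_null Y nE pG0 s0) TE.
Qed.

(** For positive definite [W], the null-based Bayes factor under prior covariance [W], kept under a
    single root so that comparisons can be made on squares. *)
Definition bf_cov (S : {set 'I_p}) (W : 'M[R]_#|S|) : R :=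
  Num.sqrt ((\det (invmx (G S) + W) * \det (G S) *
    (1 - Rsq X0 X Y S +
     quad (invmx (invmx (G S) + W)) (invmx (G S) *m z S) / T) ^+ m)^-1).

Lemma marginalE (S : {set 'I_p}) (W : 'M[R]_#|S|) : pd W ->
  marginal X0 X Y W = (nullC * bf_cov W)%:E.
Proof.
move=> pW; have pG : pd (G S) := pd_design S.
have pP : pd (invmx (G S) + W).
  by apply: pdD (pd_inv pG) (proj1 pW) _ => v; exact: pd_ge0.
set q := quad (invmx (invmx (G S) + W)) (invmx (G S) *m z S).
have q0 : 0 <= q by apply: pd_ge0; exact: pd_inv.
have QE : T - quad (invmx (G S + invmx W)) (z S) =
    T * (1 - Rsq X0 X Y S + q / T).
  rewrite quad_addmx_inv_inv// -RsqE -/q; field.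
  by rewrite gt_eqF.
have d0 : 0 < 1 - Rsq X0 X Y S + q / T.
  by rewrite ltr_pwDl ?divr_ge0 ?(ltW T0)// subr_gt0 Rsq_lt1.
apply: (etrans (integral_invgamma_ker m0
    (c := (Num.sqrt (\det W * \det (G S + invmx W) * \det (X0^T *m X0)))^-1)
    (Q := T * (1 - Rsq X0 X Y S + q / T)) _ _ _)).
- by rewrite invr_ge0 sqrtr_ge0.
- by rewrite mulr_gt0.
- move=> s s0; rewrite -QE TE.
  exact: (vec_integral_model Y nE pG0 (design_orth S) s0 pW (pd_design S)).
congr EFin; rewrite det_addmx_inv// /nullC /bf_cov -/q exprMn.
have dP := det_pd_gt0 pP; have dG := det_pd_gt0 pG; have dG0 := det_pd_gt0 pG0.
have Tm : 0 < T ^+ m by rewrite exprn_gt0.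
have dm : 0 < (1 - Rsq X0 X Y S + q / T) ^+ m by rewrite exprn_gt0.
have dPG : 0 < \det (invmx (G S) + W) * \det (G S) by rewrite mulr_gt0.
rewrite (sqrtrM _ (ltW dPG)) (sqrtrM _ (ltW Tm)) sqrtrV ?mulr_ge0 ?ltW//.
rewrite (sqrtrM _ (ltW dPG)); field.
by rewrite !gt_eqF ?sqrtr_gt0.
Qed.

Let N : R := n.+1%:R.

Let N1 : 1 < N. Proof. by rewrite ltr1n ltnS; case: (n) hn. Qed.
Let N0 : 0 < N. Proof. exact: lt_trans ltr01 N1. Qed.

Let LB_covE (S : {set 'I_p}) : LB_cov X S = (N - 1) *: invmx (G S).
Proof. by rewrite /N -natr1 addrK. Qed.

Let phi (S : {set 'I_p}) a := Num.sqrt (bf_sq #|S| m N (Rsq X0 X Y S) a).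

Lemma admissible_LB (S : {set 'I_p}) : admissible (G S) N (LB_cov X S).
Proof.
rewrite /admissible LB_covE subrr; split; first by rewrite trmx0.
by move=> v; rewrite mulmx0 mul0mx mxE.
Qed.

Lemma bf_covE (S : {set 'I_p}) (W : 'M[R]_#|S|) a :
  quad (invmx (invmx (G S) + W)) (invmx (G S) *m z S) =
    a * (Rsq X0 X Y S * T) ->
  \det (invmx (G S) + W) * \det (G S) * a = N ^+ #|S| / N ->
  0 < a -> bf_cov W = phi S a.
Proof.
move=> E1 E2 a0; rewrite /bf_cov /phi E1; congr Num.sqrt.
have -> : \det (invmx (G S) + W) * \det (G S) = N ^+ #|S| / N / a.
  by rewrite -E2 mulfK// gt_eqF.
have -> : a * (Rsq X0 X Y S * T) / T = a * Rsq X0 X Y S.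
  by field; rewrite gt_eqF.
have d0 := bf_den_gt0 (Rsq_ge0 S) (Rsq_lt1 S) (ltW a0).
rewrite /bf_sq; field.
by rewrite !gt_eqF ?exprn_gt0.
Qed.

Lemma bf_cov_LB (S : {set 'I_p}) : bf_cov (LB_cov X S) = phi S N^-1.
Proof.
have pG : pd (G S) := pd_design S.
have E : invmx (G S) + LB_cov X S = N *: invmx (G S).
  by rewrite LB_covE scalerBl scale1r addrC subrK.
apply: bf_covE; last by rewrite invr_gt0.
  by rewrite E quad_invQ// quad_inv// RsqE mulrC.
rewrite E detQ; have dG := det_pd_gt0 pG; field.
by rewrite !gt_eqF.
Qed.

Lemma Rsq_card0 (S : {set 'I_p}) : #|S| = 0%N -> Rsq X0 X Y S = 0.
Proof.
move=> S0; apply: (mulIf (lt0r_neq0 T0)); rewrite RsqE mul0r.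
move: (z S) (invmx (G S)); rewrite S0 => w A.
by rewrite [w]flatmx0 quad0.
Qed.

(** In the null model [a] comes from no matrix, but the value is at most 1 on the allowed range and
    equals 1 at [N^-1], so maximizing over [a] still gives the correct Bayes factor. *)
Lemma phi_card0 (S : {set 'I_p}) a : #|S| = 0%N -> phi S a = Num.sqrt (N * a).
Proof.
move=> S0; rewrite /phi /bf_sq S0 Rsq_card0// mulr0 addr0 subr0.
by rewrite expr1n expr0 mulr1 divr1.
Qed.

(** If [u = 0] then R^2 = 0 and both sides of [quad_dir] vanish for any direction; a nonzero one is
    still required for the determinant bound. *)
Let dir (S : {set 'I_p}) : 'cV[R]_#|S| :=
  if invmx (G S) *m z S == 0 then const_mx 1 else invmx (G S) *m z S.

Lemma dir_neq0 (S : {set 'I_p}) : (0 < #|S|)%N -> dir S != 0.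
Proof.
rewrite /dir; case: ifP => // [_|/negbT//] S0.
apply/eqP => /colP/(_ (Ordinal S0)); rewrite !mxE => /eqP.
by rewrite oner_eq0.
Qed.

Lemma quad_dir (S : {set 'I_p}) (W : 'M[R]_#|S|) : (0 < #|S|)%N ->
  quad (invmx (invmx (G S) + W)) (invmx (G S) *m z S) =
  rayleigh (G S) W (dir S) * (Rsq X0 X Y S * T).
Proof.
move=> S0; have pG : pd (G S) := pd_design S.
have g0 := proj2 pG _ (dir_neq0 S0).
rewrite RsqE -(quad_inv (z S) pG) /rayleigh; move: g0; rewrite /dir.
case: ifP => [/eqP -> _|_ g0]; first by rewrite !quad0 mulr0.
by rewrite divfK// gt_eqF.
Qed.

Lemma bf_cov_le (S : {set 'I_p}) (W : 'M[R]_#|S|) : admissible (G S) N W ->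
  exists a, [/\ 0 < a, a <= N^-1 & bf_cov W <= phi S a].
Proof.
move=> aW; have pG : pd (G S) := pd_design S.
have Ni0 : 0 < N^-1 by rewrite invr_gt0.
have [S0|S0] := posnP #|S|.
  (* There is only one 0 by 0 matrix, so [W] is the lower bound itself. *)
  exists N^-1; split => //.
  rewrite -bf_cov_LB; suff -> : W = LB_cov X S by [].
  by apply/matrixP => i; have := ltn_ord i; rewrite [X in (_ < X)%N]S0.
have [a0 aN le] := rayleigh_bound pG N1 aW (dir_neq0 S0).
set a := rayleigh _ _ _ in a0 aN le *.
exists a; split => //.
rewrite /bf_cov quad_dir// -/a /phi /bf_sq.
have -> : a * (Rsq X0 X Y S * T) / T = a * Rsq X0 X Y S.
  by field; rewrite gt_eqF.
have d0 := bf_den_gt0 (Rsq_ge0 S) (Rsq_lt1 S) (ltW a0).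
have dm : 0 < (1 - Rsq X0 X Y S + a * Rsq X0 X Y S) ^+ m by rewrite exprn_gt0.
have Nk : 0 < N ^+ #|S| by rewrite exprn_gt0.
have pP : pd (invmx (G S) + W).
  have pW := admissible_pd pG N1 aW.
  by apply: pdD (pd_inv pG) (proj1 pW) _ => v; exact: pd_ge0.
have D0 : 0 < \det (invmx (G S) + W) * \det (G S).
  by rewrite mulr_gt0 ?det_pd_gt0.
set D := \det (invmx (G S) + W) * \det (G S) in le D0 *; clearbody D.
rewrite ler_sqrt; last exact: ltW (bf_sq_gt0 _ _ N0 (Rsq_ge0 S) (Rsq_lt1 S) a0).
rewrite !invfM mulrA ler_pM2r ?invr_gt0//.
rewrite ler_pdivlMr// [leLHS]mulrC ler_pdivrMr//.
have -> : N * a * D = D * a * N by ring.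
by rewrite -ler_pdivrMr.
Qed.

(** An inequality rather than an equality, so as to cover the null model, where [phi S a] may lie
    below 1. *)
Lemma bf_cov_attained (S : {set 'I_p}) a : 0 < a -> a <= N^-1 ->
  exists2 W : 'M[R]_#|S|, admissible (G S) N W & phi S a <= bf_cov W.
Proof.
move=> a0 aN; have pG : pd (G S) := pd_design S.
have [S0|S0] := posnP #|S|.
  exists (LB_cov X S); first exact: admissible_LB.
  rewrite bf_cov_LB !phi_card0// ler_sqrt; first by rewrite ler_pM2l.
  by rewrite mulfV ?gt_eqF// ltr01.
have [W [aW ra dE]] := rayleigh_attained pG N1 (dir_neq0 S0) a0 aN.
by exists W => //; rewrite (@bf_covE S W a)// quad_dir// ra.
Qed.

Lemma bf_LB (S : {set 'I_p}) : BF0 X0 X Y LB S = phi S N^-1.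
Proof.
have aLB := admissible_pd (pd_design S) N1 (admissible_LB S).
rewrite /BF0 marginal_nullE marginalE//= bf_cov_LB mulrC mulKf//.
by rewrite gt_eqF.
Qed.

(** [bf_cov_le] bounds every admissible covariance by the scalar maximum and [bf_cov_attained]
    supplies a matrix reaching it, so the two maxima agree. *)
Lemma bf_ML (S : {set 'I_p}) :
  exists a, [/\ 0 < a, a <= N^-1, BF0 X0 X Y ML S = phi S a &
  forall a', 0 < a' -> a' <= N^-1 -> phi S a' <= BF0 X0 X Y ML S].
Proof.
have pG : pd (G S) := pd_design S.
have [a [a0 aN amax]] :=
  bf_sq_argmax #|S| m N0 (Rsq_ge0 S) (Rsq_lt1 S).
have phimax a' : 0 < a' -> a' <= N^-1 -> phi S a' <= phi S a.
  move=> a'0 a'N; rewrite ler_sqrt ?amax//.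
  by rewrite ltW// bf_sq_gt0 ?Rsq_ge0 ?Rsq_lt1.
have up W : admissible (G S) N W -> bf_cov W <= phi S a.
  by move=> /bf_cov_le[a' [a'0 a'N /le_trans]]; apply; exact: phimax.
have adm W : psd (W - LB_cov X S) <-> admissible (G S) N W by rewrite LB_covE.
have [Ws aWs Wsa] := bf_cov_attained S a0 aN.
have pWs := admissible_pd pG N1 aWs.
(* The set of maximizers is inhabited, so [get] in [ML_cov] returns a true maximizer and not its
   default value. *)
have memWs : ML_cov_set X0 X Y Ws.
  split; first exact/adm.
  move=> W /adm aW.
  rewrite (marginalE pWs) (marginalE (admissible_pd pG N1 aW)) lee_fin.
  rewrite ler_pM2l//.
  exact: le_trans (up _ aW) Wsa.
have [/adm aM Mmax] : ML_cov_set X0 X Y (ML_cov X0 X Y S).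
  exact: getPex (ex_intro _ Ws memWs).
have pM := admissible_pd pG N1 aM.
have BE : BF0 X0 X Y ML S = bf_cov (ML_cov X0 X Y S).
  by rewrite /BF0 marginal_nullE marginalE//= mulrC mulKf// gt_eqF.
have ME : bf_cov (ML_cov X0 X Y S) = phi S a.
  apply/le_anti; rewrite up//=; apply: le_trans Wsa _.
  have := Mmax Ws (proj1 memWs).
  by rewrite (marginalE pWs) (marginalE pM) lee_fin ler_pM2l.
by exists a; split => //; rewrite BE ME.
Qed.

Lemma bf_BIC (S : {set 'I_p}) :
  BF0 X0 X Y BIC S = Num.sqrt (bic_sq #|S| n (Rsq X0 X Y S)).
Proof.
have r1 : 0 < 1 - Rsq X0 X Y S by rewrite subr_gt0 Rsq_lt1.
rewrite /BF0 !powR_half ?ler0n ?(ltW r1)// /bic_sq.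
rewrite sqrtrV ?mulr_ge0 ?exprn_ge0 ?ler0n ?(ltW r1)//.
by rewrite sqrtrM ?exprn_ge0 ?ler0n// invfM.
Qed.

Lemma bf_gt0 A (S : {set 'I_p}) : 0 < BF0 X0 X Y A S.
Proof.
have phi0 a : 0 < a -> 0 < phi S a.
  by move=> a0; rewrite sqrtr_gt0 bf_sq_gt0 ?Rsq_ge0 ?Rsq_lt1.
case: A.
- rewrite bf_BIC sqrtr_gt0 invr_gt0 mulr_gt0 ?exprn_gt0 ?subr_gt0 ?Rsq_lt1//.
  by rewrite ltr0n (leq_ltn_trans _ hn).
- by have [a [a0 _ -> _]] := bf_ML S; exact: phi0.
- by rewrite bf_LB phi0// invr_gt0.
Qed.

Let bf_sqW (S : {set 'I_p}) a : 0 < a ->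
  0 <= bf_sq #|S| m N (Rsq X0 X Y S) a.
Proof. by move=> a0; rewrite ltW// bf_sq_gt0 ?Rsq_ge0 ?Rsq_lt1. Qed.

(* The maximizer of the larger model competes in the maximum of the smaller. *)
Lemma bf_ML_BIC (I J : {set 'I_p}) : I \subset J ->
  BF0 X0 X Y ML J * BF0 X0 X Y BIC I <= BF0 X0 X Y BIC J * BF0 X0 X Y ML I.
Proof.
move=> IJ; have [a [a0 aN -> _]] := bf_ML J.
have [_ [_ _ _ /(_ a a0 aN) le]] := bf_ML I.
apply: le_trans (ler_wpM2l (ltW (bf_gt0 BIC J)) le).
have bic0 (S : {set 'I_p}) : 0 <= bic_sq #|S| n (Rsq X0 X Y S).
  by rewrite invr_ge0 mulr_ge0 ?exprn_ge0 ?subr_ge0 ?(ltW (Rsq_lt1 _)).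
rewrite !bf_BIC -!sqrtrM ?bf_sqW// ler_sqrt; last first.
  exact: mulr_ge0 (bic0 _) (bf_sqW _ a0).
have := @bic_sq_cross R #|I| #|J| m p0 (Rsq X0 X Y I) (Rsq X0 X Y J) a.
rewrite /= -nE; apply; rewrite ?Rsq_ge0 ?Rsq_lt1 ?Rsq_le ?subset_leq_card//.
by rewrite (leq_ltn_trans _ hn).
Qed.

(** Here the maximizer of the smaller model competes in the maximum of the larger, and is compared
    with the lower bound point [N^-1] by [bf_sq_cross]. *)
Lemma bf_LB_ML (I J : {set 'I_p}) : I \subset J ->
  BF0 X0 X Y LB J * BF0 X0 X Y ML I <= BF0 X0 X Y ML J * BF0 X0 X Y LB I.
Proof.
move=> IJ; have [a [a0 aN -> _]] := bf_ML I.
have [_ [_ _ _ /(_ a a0 aN) le]] := bf_ML J.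
apply: le_trans (ler_wpM2r (ltW (bf_gt0 LB I)) le).
have Ni0 : 0 < N^-1 by rewrite invr_gt0.
rewrite !bf_LB -!sqrtrM ?bf_sqW// ler_sqrt; last first.
  exact: mulr_ge0 (bf_sqW _ a0) (bf_sqW _ Ni0).
by apply: bf_sq_cross; rewrite ?Rsq_ge0 ?Rsq_lt1 ?Rsq_le.
Qed.

End models.

(** * Posterior model probabilities *)

(** After cross-multiplication the two sums compare term by term. The denominators are positive
    because weights with sum 1 cannot all vanish. *)
Lemma weighted_ratio_le (R : realFieldType) (K : finType) (w f g : K -> R) k :
  (forall i, 0 <= w i) -> \sum_i w i = 1 ->
  (forall i, 0 < f i) -> (forall i, 0 < g i) ->
  (forall i, g k * f i <= f k * g i) ->
  w k * g k / (\sum_i w i * g i) <= w k * f k / (\sum_i w i * f i).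
Proof.
move=> w0 w1 f0 g0 fg.
have sum_gt0 h : (forall i, 0 < h i) -> 0 < \sum_i w i * h i.
  move=> h0; rewrite lt_def sumr_ge0 ?andbT; last first.
    by move=> i _; rewrite mulr_ge0// ltW.
  rewrite psumr_neq0; last by move=> i _; rewrite mulr_ge0// ltW.
  apply/hasP; have : \sum_i w i != 0 by rewrite w1 oner_eq0.
  rewrite psumr_neq0// => /hasP[i ii /andP[_ wi]].
  by exists i => //=; rewrite mulr_gt0.
rewrite ler_pdivrMr ?sum_gt0// mulrAC ler_pdivlMr ?sum_gt0//.
rewrite -!mulrA ler_wpM2l// !mulr_sumr ler_sum// => i _.
by rewrite !(mulrCA _ (w i)) ler_wpM2l.
Qed.

Theorem proposition2 (R : realType) (n p0 p : nat)
    (X0 : 'M[R]_(n, p0)) (X : 'M[R]_(n, p)) (Y : 'cV[R]_n)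
    (hfree : row_free (row_mx X0 X)^T)
    (horth : X0^T *m X = 0)
    (hn : (p + p0 < n)%N)
    (hSSE : 0 < SSE (row_mx X0 X) Y) :
  (forall I J : {set 'I_p}, I \subset J ->
     BF X0 X Y BIC J I >= BF X0 X Y ML J I /\
     BF X0 X Y ML J I >= BF X0 X Y LB J I)
  /\
  (forall prior : {set 'I_p} -> R,
     (forall S, 0 <= prior S) ->
     \sum_(S : {set 'I_p}) prior S = 1 ->
     [/\ posterior X0 X Y prior BIC [set: 'I_p]%SET
           >= posterior X0 X Y prior ML [set: 'I_p]%SET,
         posterior X0 X Y prior ML [set: 'I_p]%SET
           >= posterior X0 X Y prior LB [set: 'I_p]%SET,
         posterior X0 X Y prior BIC finset.set0
           <= posterior X0 X Y prior ML finset.set0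
       & posterior X0 X Y prior ML finset.set0
           <= posterior X0 X Y prior LB finset.set0]).
Proof.
have pos A S : 0 < BF0 X0 X Y A S by exact: bf_gt0.
have ML_BIC (I J : {set 'I_p}) : I \subset J ->
    BF0 X0 X Y ML J * BF0 X0 X Y BIC I <= BF0 X0 X Y BIC J * BF0 X0 X Y ML I.
  exact: bf_ML_BIC.
have LB_ML (I J : {set 'I_p}) : I \subset J ->
    BF0 X0 X Y LB J * BF0 X0 X Y ML I <= BF0 X0 X Y ML J * BF0 X0 X Y LB I.
  exact: bf_LB_ML.
(* From here on, only positivity of the Bayes factors and the two cross-multiplied inequalities
   matter. *)
rewrite /posterior /BF; move: (BF0 X0 X Y) pos ML_BIC LB_ML.
move=> bf pos ML_BIC LB_ML; split=> [I J IJ|prior w0 w1].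
  by split; rewrite ler_pdivrMr// mulrAC ler_pdivlMr// ?ML_BIC ?LB_ML.
split; apply: weighted_ratio_le => // K.
- by apply: ML_BIC; rewrite finset.subsetT.
- by apply: LB_ML; rewrite finset.subsetT.
(* Each [K] contains the null model, so [K] is now the larger model and the inequality reverses. *)
- by rewrite mulrC [leRHS]mulrC; apply: ML_BIC; rewrite finset.sub0set.
- by rewrite mulrC [leRHS]mulrC; apply: LB_ML; rewrite finset.sub0set.
Qed.
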